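(* Let $X_n(\theta)$, for $n\in\mathbb{N}_0$ and a fixed $\theta\in\{0,1\}^{\mathbb{N}}$, be the depth of the first free node along the path $\theta$ in the random digital search tree $T_n$ built from $n$ independent random variables uniformly distributed on the unit interval. For $0\le\eta\le 1$ let $Q_\eta$ be the distribution of $\lfloor -\log_2 S_\infty+\eta\rfloor$, where $S_\infty=\sum_{k=0}^\infty 2^{-k}Y_{\infty,k}$ with $(Y_{\infty,k})_{k\in\mathbb{N}_0}$ independent and all exponentially distributed with parameter $2$. Then, for every $\gamma<1$, $$d_{\mathrm{TV}}\bigl(\mathcal{L}(X_n(\theta)-\lfloor\log_2 n\rfloor),\,Q_{\{\log_2 n\}}\bigr)=o(n^{-\gamma})\quad\text{as } n\to\infty.$$
   Context: $\mathbb{N}=\{1,2,\dots\}$, $\mathbb{N}_0=\{0,1,2,\dots\}$. Nodes of a binary tree are finite strings of 0's and 1's (the empty string is the root; 0 means move left, 1 means move right); the depth of a node is the length of the string. Let $(U_n)_{n\in\mathbb{N}}$ be independent random variables, each uniformly distributed on the unit interval. The digital search tree (DST) algorithm produces random trees (finite sets of occupied nodes) $T_0,T_1,T_2,\dots$ as follows: $T_0$ is empty; given $T_n$, the value $U_{n+1}$ is inserted by traveling from the root in the directions given by the successive bits of the binary expansion of $U_{n+1}$ until a node not in $T_n$ is found, and $T_{n+1}$ is $T_n$ together with this node (in particular $U_1$ is put into the root). For $\theta=(\theta_1,\theta_2,\dots)\in\{0,1\}^{\mathbb{N}}$, $X_n(\theta):=\min\{k\in\mathbb{N}_0: (\theta_1,\dots,\theta_k)\notin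 T_n\}$, so $X_0(\theta)=0$. Equivalently, $(X_n(\theta))_{n\in\mathbb{N}_0}$ is a Markov chain on $\mathbb{N}_0$ started at $0$ with transition probabilities $p_{k,k+1}=1-p_{k,k}=2^{-k}$ for all $k\in\mathbb{N}_0$. The exponential distribution with parameter $\lambda$ has mean $1/\lambda$. $\mathcal{L}(X)$ denotes the distribution of $X$; $\lfloor x\rfloor$ is the greatest integer $\le x$ and $\{x\}=x-\lfloor x\rfloor$. The total variation distance is $d_{\mathrm{TV}}(\mu,\nu)=\sup_B|\mu(B)-\nu(B)|$, the supremum being over Borel sets $B$; for $\mu,\nu$ concentrated on $\mathbb{Z}$ it equals $\frac12\sum_{j\in\mathbb{Z}}|\mu(\{j\})-\nu(\{j\})|$. *)

(* Defs.v *)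
From HB Require Import structures.
From mathcomp Require Import all_boot all_order all_algebra.
From mathcomp Require Import finmap.
From mathcomp Require Import all_classical all_reals all_analysis.

Set Implicit Arguments.
Unset Strict Implicit.
Unset Printing Implicit Defensive.

Import Order.TTheory GRing.Theory Num.Theory.
Import numFieldNormedType.Exports.

Local Open Scope classical_set_scope.
Local Open Scope ring_scope.

(* Nodes are finite bit strings; [mkseq theta k] is the prefix of length k of
   the infinite path [theta], whose bits are numbered from 0. *)
Section digital_search_tree.

Lemma exists_free (t : {fset seq bool}) (theta : nat -> bool) :
  exists k, mkseq theta k \notin t.
Proof.
apply: contrapT => /forallNP h.
pose s := map (mkseq theta) (iota 0 (size t).+1).
have us : uniq s.
  rewrite map_inj_uniq ?iota_uniq// => i j /(congr1 size).
  by rewrite !size_mkseq.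
have sub : {subset s <= enum_fset t}.
  by move=> _ /mapP[k _ ->]; have /negP := h k; rewrite negbK.
by have := uniq_leq_size us sub; rewrite size_map size_iota ltnn.
Qed.

Definition first_free (t : {fset seq bool}) (theta : nat -> bool) : nat :=
  ex_minn (exists_free t theta).

(* The digit of index k + 1 of the binary expansion of x in [0, 1[; dyadic
   rationals get their terminating expansion. *)
Definition binary_digit (R : realType) (x : R) (k : nat) : bool :=
  odd (Num.truncn (2 ^+ k.+1 * x)).

(* [dst u n] is the tree obtained from the first n input values
   u 0, ..., u n.-1. *)
Fixpoint dst (R : realType) (u : nat -> R) (n : nat) : {fset seq bool} :=
  if n is m.+1 then
    let t := dst u m in
    let path := binary_digit (u m) in
    (mkseq path (first_free t path) |` t)%fset
  else fset0.

End digital_search_tree.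

Section probability.
Context (R : realType).

Definition mutually_independent (d : measure_display) (T : measurableType d)
    (P : probability T R) (I : choiceType) (X : I -> {RV P >-> R}) : Prop :=
  forall (J : {fset I}) (B : I -> set R),
    (forall i, measurable (B i)) ->
    P (\bigcap_(i in [set` J]) (X i @^-1` B i)) =
    (\big[*%E/1%E]_(i <- J) P (X i @^-1` B i))%E.

(* Set functions are compared on Borel sets only: the value of a measure on
   other sets carries no information. *)
Definition has_law (d : measure_display) (T : measurableType d)
    (P : probability T R) (X : {RV P >-> R}) (mu : set R -> \bar R) : Prop :=
  forall B : set R, measurable B -> distribution P X B = mu B.

Definition dTV (mu nu : set R -> \bar R) : R :=
  sup [set `|fine (mu B) - fine (nu B)| | B in (measurable : set (set R))].

Definition log2 (x : R) : R := ln x / ln 2.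

Definition frac_part (x : R) : R := x - (Num.floor x)%:~R.

End probability.

Section limit_law.
Context (R : realType) (d : measure_display) (T : measurableType d).
Context (P : probability T R).

(* The series of exponential variables converges almost surely; where it does
   not, [limn] has an arbitrary value. *)
Definition S_infty (Y : nat -> {RV P >-> R}) (w : T) : R :=
  limn (series (fun k : nat => 2 ^- k * Y k w)).

(* Integer-valued variables are embedded in R, so that all laws live on the
   Borel sets of R. *)
Definition Q (Y : nat -> {RV P >-> R}) (eta : R) : set R -> \bar R :=
  pushforward P
    (fun w : T => (Num.floor (- log2 (S_infty Y w) + eta))%:~R : R).

End limit_law.

Section depth.
Context (R : realType) (d : measure_display) (T : measurableType d).
Context (P : probability T R).

Definition free_depth (U : nat -> {RV P >-> R}) (theta : nat -> bool)
    (n : nat) (w : T) : nat :=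
  first_free (dst (fun i => U i w) n) theta.

Definition centered_depth_law (U : nat -> {RV P >-> R}) (theta : nat -> bool)
    (n : nat) : set R -> \bar R :=
  pushforward P
    (fun w : T => (free_depth U theta n w)%:R
                  - (Num.floor (log2 (n%:R : R)))%:~R : R).

End depth.

(* Main.v *)
From HB Require Import structures.
Require Import Defs.
From mathcomp Require Import all_boot all_order all_algebra.
From mathcomp Require Import finmap.
From mathcomp Require Import all_classical all_reals all_analysis.
From mathcomp Require Import measurable_realfun ring lra zify.

Import Order.TTheory GRing.Theory Num.Theory.
Import numFieldNormedType.Exports.

Local Open Scope classical_set_scope.
Local Open Scope ring_scope.

(** Write [h n k] for the probability that the depth [X_n] is at least [k], [F]
    for the distribution function of [S_infty], and [H n k = F (n / 2 ^ k)] for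
    the probability that [Z_n = floor (log2 n - log2 S_infty)] is at least [k].
    Up to the common shift by [floor (log2 n)], the two laws to be compared are
    those of [X_n] and [Z_n], and the point is that [h] and [H] obey almost the
    same recursion.

    A new key lengthens the occupied part of the path [theta] exactly when its
    first [X_n] digits agree with [theta] ([first_free_dstS]), which, given the
    past, has probability [2 ^- X_n] ([depth_indep]).  With [p = 2 ^- k] this
    reads
      [h (n + 1) (k + 1) = (1 - p) * h n (k + 1) + p * h n k].
    On the other side [S_infty = Y_0 + S' / 2], with [S'] an independent copy of
    [S_infty], and the lack of memory of the exponential variable [Y_0] gives
      [2 t (F (2 x) - F (x + t)) <= F (x + t) - F x
                                 <= 2 t (F (2 (x + t)) - F x)]
    ([S_cdf_incr_ge], [S_cdf_incr_le]).  At [x = n / 2 ^ (k + 1)] and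
    [t = 2 ^- (k + 1)] this says that [H] satisfies the recursion of [h] up to
    an error of at most [p] times the sum of the increments in [n] of [H n k]
    and [H n (k + 1)].

    These increments telescope.  Summing the recursion for [e = h - H] over [n]
    therefore bounds [\sum_n |e n k|] by a linear function of [k]; summing it
    with weights [n] bounds [\sum_n n |e n k|] by [2 ^ k] times such a function
    and, from the boundary term of the telescoping sum, gives
      [n |e n k| <= 8 k + 64]
    uniformly in [n] and [k] ([birth_chain_comparison]).  Besides the two
    increment inequalities this only uses the exponential tail of [S_infty]
    ([S_cdf_tail]), which comes from a union bound over the [Y_k].

    Finally both variables live in the window of levels [k < K], with
    [K] of order [2 log2 n], up to probability [O(log n / n)], so that the
    total variation distance is at most the sum of the [O(log n)] errors of size
    [O(log n / n)] ([depth_approximation]).  The resulting bound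
    [O((log n) ^ 2 / n)] is [o(n ^ - gamma)] for every [gamma < 1]. *)

(** * Comparison of the two recursions *)

Section birth_chain_comparison.
Context (R : realType).
Implicit Types (n N k : nat).

Lemma sum_expR_le (c : R) N : 0 < c ->
  \sum_(n < N) expR (- (n%:R * c)) <= 1 + c^-1.
Proof.
move=> c0; set q := expR (- c).
have q1 : q <= (1 + c)^-1.
  by rewrite /q expRN lef_pV2 ?posrE ?expR_gt0 ?expR_ge1Dx//; lra.
have gap : c / (1 + c) <= 1 - q.
  have -> : c / (1 + c) = 1 - (1 + c)^-1 by field; lra.
  by rewrite lerD2l lerN2.
have E : (1 - q) * \sum_(n < N) expR (- (n%:R * c)) <= 1.
  have -> : (1 - q) * \sum_(n < N) expR (- (n%:R * c)) = 1 - q ^+ N.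
    elim: N => [|N IH]; first by rewrite big_ord0 mulr0 expr0 subrr.
    rewrite big_ord_recr/= mulrDr IH exprS.
    have -> : expR (- (N%:R * c)) = q ^+ N.
      by rewrite /q -expRM_natl mulrN mulr_natl.
    by ring.
  by rewrite lerBlDr lerDl exprn_ge0 ?expR_ge0.
have S0 : 0 <= \sum_(n < N) expR (- (n%:R * c)).
  by apply: sumr_ge0 => i _; exact: expR_ge0.
have : c / (1 + c) * \sum_(n < N) expR (- (n%:R * c)) <= 1.
  by apply: le_trans E; exact: ler_wpM2r.
have -> : 1 + c^-1 = (c / (1 + c))^-1 by field; lra.
by rewrite -ler_pdivlMl ?mulr1// divr_gt0//; lra.
Qed.

(** Both terms on the left are of use: for [0 <= v] the first is bounded alone, and
    for [0 <= u] the second, which is how one summation of a recursion yields both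
    a supremum bound and a summability bound. *)
Lemma ler_telescope (u v g : nat -> R) :
  u 0 = 0 -> (forall n, u n.+1 + v n <= u n + g n) ->
  forall N, u N + \sum_(n < N) v n <= \sum_(n < N) g n.
Proof.
move=> u0 H; elim=> [|N IH]; first by rewrite !big_ord0 u0 addr0.
by rewrite !big_ord_recr/=; have := H N; lra.
Qed.

Lemma sum_weighted_increment (u : nat -> R) N :
  \sum_(n < N) n.+1%:R * (u n.+1 - u n) = \sum_(n < N) (u N - u n).
Proof.
elim: N => [|N IH]; first by rewrite !big_ord0.
rewrite !big_ord_recr/= IH.
have -> : \sum_(n < N) (u N.+1 - u n) = \sum_(n < N) (u N - u n) + N%:R * (u N.+1 - u N).
  by rewrite -[N in N%:R]card_ord -sum1_card natr_sum mulr_suml -big_split/=;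
     apply: eq_bigr => i _; ring.
by rewrite -(natr1 N); ring.
Qed.

(* [F] is the distribution function of the limit, [h n k] the probability that
   the discrete chain is at level at least [k] at time [n]. *)
Variable F : R -> R.
Hypothesis F_le1 : forall x, F x <= 1.
Hypothesis F_nd : {homo F : x y / x <= y}.
Hypothesis F0 : F 0 = 0.
Hypothesis F_tail : forall x, 0 <= x -> 1 - F x <= 2 * expR (- (x / 2)).
Hypothesis F_incr_le : forall x t, 0 <= x -> 0 <= t ->
  F (x + t) - F x <= 2 * t * (F (2 * (x + t)) - F x).
Hypothesis F_incr_ge : forall x t, 0 <= x -> 0 <= t ->
  2 * t * (F (2 * x) - F (x + t)) <= F (x + t) - F x.

Variable h : nat -> nat -> R.
Hypothesis h_root : forall n, h n 0 = 1.
Hypothesis h_start : forall k, h 0 k.+1 = 0.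
Hypothesis h_step : forall n k,
  h n.+1 k.+1 = (1 - 2 ^- k) * h n k.+1 + 2 ^- k * h n k.

Let H n k := F (n%:R / 2 ^+ k).
Let e n k := h n k - H n k.
Let D n k := H n.+1 k - H n k.
Let p k : R := 2 ^- k.

Let p_gt0 k : 0 < p k.
Proof. by rewrite /p invr_gt0 exprn_gt0. Qed.
Let p_le1 k : p k <= 1.
Proof. by rewrite /p invf_le1 ?exprn_gt0// exprn_ege1// ler1n. Qed.
Let pE k : p k * 2 ^+ k = 1.
Proof. by rewrite /p mulVf// expf_neq0. Qed.

Let H_ge0 n k : 0 <= H n k.
Proof. by rewrite -F0; apply: F_nd; rewrite divr_ge0// exprn_ge0. Qed.

Let D_ge0 n k : 0 <= D n k.
Proof.
rewrite subr_ge0; apply: F_nd; rewrite ler_pM2r ?invr_gt0 ?exprn_gt0//.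
by rewrite ler_nat.
Qed.

Let H_gap N k : \sum_(n < N) (1 - H n k) <= 6 * 2 ^+ k.
Proof.
have q0 : 0 < p k / 2 by rewrite divr_gt0.
apply: (@le_trans _ _ (2 * (1 + (p k / 2)^-1))).
  apply: (@le_trans _ _ (2 * \sum_(n < N) expR (- (n%:R * (p k / 2))))).
    rewrite mulr_sumr; apply: ler_sum => n _.
    by apply: le_trans (F_tail _ _) _; rewrite ?divr_ge0 ?exprn_ge0// /p !mulrA.
  by rewrite ler_pM2l// sum_expR_le.
rewrite /p invfM !invrK.
have : (1 : R) <= 2 ^+ k by rewrite exprn_ege1// ler1n.
lra.
Qed.

Let D_sum N k : \sum_(n < N) D n k <= 1.
Proof.
have -> : \sum_(n < N) D n k = H N k - H 0 k.
  elim: N => [|N IH]; first by rewrite big_ord0 subrr.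
  by rewrite big_ord_recr/= IH /D; ring.
by rewrite lerBlDr (le_trans (F_le1 _))// lerDl.
Qed.

Let D_wsum N k : \sum_(n < N) n.+1%:R * D n k <= 6 * 2 ^+ k.
Proof.
rewrite (sum_weighted_increment (H^~ k)); apply: le_trans (H_gap N k).
by apply: ler_sum => n _; rewrite lerD2r; exact: F_le1.
Qed.

(* The increment inequalities at [x = n / 2 ^ (k + 1)], [t = 2 ^- (k + 1)], where
   [2 * t = p k] and [2 * x = n / 2 ^ k], say that [H] solves the recursion of [h]
   up to the increments [D]. *)
Let step n k :
  `|e n.+1 k.+1| <= (1 - p k) * `|e n k.+1|
                    + p k * (`|e n k| + (D n k + D n k.+1)).
Proof.
set r := H n.+1 k.+1 - (1 - p k) * H n k.+1 - p k * H n k.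
have -> : e n.+1 k.+1 = (1 - p k) * e n k.+1 + p k * e n k - r.
  by rewrite /e h_step /r -/(p k); ring.
have xe : 2 * (n%:R / 2 ^+ k.+1) = n%:R / 2 ^+ k :> R.
  by rewrite exprS; field; rewrite expf_neq0.
have xt : n%:R / 2 ^+ k.+1 + 2 ^- k.+1 = n.+1%:R / 2 ^+ k.+1 :> R.
  by rewrite -(natr1 n) mulrDl mul1r.
have xt2 : 2 * (n.+1%:R / 2 ^+ k.+1) = n.+1%:R / 2 ^+ k :> R.
  by rewrite exprS; field; rewrite expf_neq0.
have pt : 2 * 2 ^- k.+1 = p k by rewrite /p exprS; field; rewrite expf_neq0.
have x0 : 0 <= n%:R / 2 ^+ k.+1 :> R by rewrite divr_ge0// exprn_ge0.
have t0 : 0 <= 2 ^- k.+1 :> R by rewrite invr_ge0 exprn_ge0.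
have := F_incr_le _ _ x0 t0; have := F_incr_ge _ _ x0 t0.
rewrite xt xt2 xe pt -!/(H _ _) => lo up.
have rD : `|r| <= p k * (D n k + D n k.+1).
  have a := mulr_ge0 (ltW (p_gt0 k)) (D_ge0 n k).
  have b := mulr_ge0 (ltW (p_gt0 k)) (D_ge0 n k.+1).
  by move: a b lo up; rewrite ler_norml /r /D => a b lo up; apply/andP; split; nra.
apply: le_trans (ler_normB _ _) _.
have := ler_normD ((1 - p k) * e n k.+1) (p k * e n k).
rewrite !normrM (ger0_norm (ltW (p_gt0 k))) ger0_norm ?subr_ge0//.
by move: rD; lra.
Qed.

Let e_start k : e 0 k.+1 = 0.
Proof. by rewrite /e h_start /H mul0r F0 subrr. Qed.

Let e_root n : `|e n 0| <= 2 * expR (- (n%:R / 2)).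
Proof.
rewrite /e h_root /H expr0 divr1 ger0_norm ?subr_ge0 ?F_le1//.
exact: F_tail.
Qed.

(* The increments [D] sum to at most 1, so that each level adds at most 2 to the
   total error of the level below, whatever the value of [p k]. *)
Let e_sum N k : \sum_(n < N) `|e n k| <= 6 + 2 * k%:R.
Proof.
elim: k N => [|k IH] N.
  rewrite mulr0 addr0.
  apply: (@le_trans _ _ (2 * (1 + (2^-1)^-1))); last by rewrite invrK; lra.
  apply: (@le_trans _ _ (2 * \sum_(n < N) expR (- (n%:R * 2^-1)))).
    by rewrite mulr_sumr; apply: ler_sum => n _; exact: e_root.
  by rewrite ler_pM2l// sum_expR_le.
have st n : `|e n.+1 k.+1| + p k * `|e n k.+1| <=
    `|e n k.+1| + p k * (`|e n k| + (D n k + D n k.+1)).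
  by have := step n k; lra.
have e0 : `|e 0 k.+1| = 0 by rewrite e_start normr0.
have := ler_telescope _ _ _ e0 st N.
rewrite -!mulr_sumr big_split/= [X in p k * (_ + X)]big_split/= => T.
have : p k * \sum_(n < N) `|e n k.+1| <= p k * (6 + 2 * k.+1%:R).
  apply: (@le_trans _ _ (`|e N k.+1| + p k * \sum_(n < N) `|e n k.+1|)).
    by rewrite lerDr.
  apply: le_trans T _; rewrite ler_pM2l//.
  by have := IH N; have := D_sum N k; have := D_sum N k.+1; rewrite -(natr1 k); lra.
by rewrite ler_pM2l.
Qed.

(* [x * expR (- (x / 2))] is traded for [4 * expR (- (x / 4))], which leaves a
   geometric sum. *)
Let root_wsum N : \sum_(n < N) n%:R * `|e n 0| <= 40.
Proof.
apply: (@le_trans _ _ (8 * (1 + (4^-1)^-1))); last by rewrite invrK; lra.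
apply: (@le_trans _ _ (8 * \sum_(n < N) expR (- (n%:R * 4^-1)))); last first.
  by rewrite ler_pM2l// sum_expR_le// invr_gt0.
rewrite mulr_sumr; apply: ler_sum => n _.
apply: le_trans (ler_wpM2l _ (e_root n)) _ => //.
set x : R := n%:R; have -> : - (x / 2) = - (x * 4^-1) + - (x * 4^-1) by field.
rewrite expRD.
have q0 := expR_gt0 (- (x * 4^-1)).
have : x * 4^-1 * expR (- (x * 4^-1)) <= 1.
  rewrite expRN -ler_pdivlMr ?invr_gt0 ?expR_gt0// invrK mul1r.
  by have := expR_ge1Dx (x * 4^-1); lra.
by nra.
Qed.

(* The same summation with weights [n]: [p k] times a sum of order [2 ^+ k] is
   bounded, and the boundary term at [N] survives on the left. *)
Let wstep N k :
  N%:R * `|e N k.+1| + p k * \sum_(n < N) n%:R * `|e n k.+1| <=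
  p k * \sum_(n < N) n%:R * `|e n k| + (4 * k.+1%:R + 28).
Proof.
have st n : n.+1%:R * `|e n.+1 k.+1| + p k * (n%:R * `|e n k.+1|) <=
    n%:R * `|e n k.+1| + (`|e n k.+1| + p k * (n%:R * `|e n k| + `|e n k|
              + (n.+1%:R * D n k + n.+1%:R * D n k.+1))).
  have := step n k.
  have n0 : 0 <= n%:R :> R by [].
  rewrite -(natr1 n) => /(ler_wpM2l (addr_ge0 n0 ler01)) s.
  have := mulr_ge0 (ltW (p_gt0 k)) (normr_ge0 (e n k.+1)).
  by move: s; lra.
have T := ler_telescope (fun n => n%:R * `|e n k.+1|) _ _ (mul0r _) st N.
move: T; rewrite big_split/= -!mulr_sumr big_split/= [X in p k * (X + _)]big_split/=.
rewrite [X in p k * (_ + X)]big_split/= => T.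
apply: le_trans T _.
have E1 := e_sum N k.+1; have E0 := e_sum N k.
have D1 := D_wsum N k.+1; have D0 := D_wsum N k.
have pD1 : p k * \sum_(n < N) n.+1%:R * D n k.+1 <= 12.
  apply: le_trans (ler_wpM2l (ltW (p_gt0 k)) D1) _.
  by rewrite exprS; have := pE k; nra.
have pD0 : p k * \sum_(n < N) n.+1%:R * D n k <= 6.
  apply: le_trans (ler_wpM2l (ltW (p_gt0 k)) D0) _.
  by have := pE k; nra.
have pE0 : p k * \sum_(n < N) `|e n k| <= 6 + 2 * k%:R.
  apply: le_trans E0; rewrite ler_piMl//.
  by apply: sumr_ge0.
by move: E1; rewrite -(natr1 k); nra.
Qed.

Let e_wsum N k : \sum_(n < N) n%:R * `|e n k| <= 2 ^+ k * (4 * k%:R + 40).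
Proof.
elim: k N => [|k IH] N; first by rewrite mulr0 add0r expr0 mul1r root_wsum.
rewrite -(ler_pM2l (p_gt0 k)).
have : p k * \sum_(n < N) n%:R * `|e n k.+1| <=
  p k * \sum_(n < N) n%:R * `|e n k| + (4 * k.+1%:R + 28).
  by apply: le_trans (wstep N k); rewrite lerDr mulr_ge0.
move=> /le_trans; apply.
have := ler_wpM2l (ltW (p_gt0 k)) (IH N).
rewrite mulrA pE mul1r exprS.
rewrite (_ : p k * (2 * 2 ^+ k * _) = (p k * 2 ^+ k) * (2 * (4 * k.+1%:R + 40))).
  by rewrite pE -(natr1 k); lra.
by ring.
Qed.

(** The boundary term of [wstep] is at most [p k] times the bound of [e_wsum] at the
    level below; that product is linear in [k], because [p k * 2 ^+ k = 1]. *)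
Lemma birth_chain_comparison n k : n%:R * `|h n k - F (n%:R / 2 ^+ k)| <= 8 * k%:R + 64.
Proof.
rewrite -/(H n k) -/(e n k).
case: k => [|k].
  rewrite mulr0 add0r; have := e_root n; set x : R := n%:R => ex.
  have x0 : 0 <= x by [].
  apply: le_trans (ler_wpM2l x0 ex) _.
  have q0 := expR_gt0 (- (x / 2)).
  have : x / 2 * expR (- (x / 2)) <= 1.
    rewrite expRN -ler_pdivlMr ?invr_gt0 ?expR_gt0// invrK mul1r.
    by have := expR_ge1Dx (x / 2); lra.
  by nra.
have : n%:R * `|e n k.+1| <=
  p k * \sum_(i < n) i%:R * `|e i k| + (4 * k.+1%:R + 28).
  apply: le_trans (wstep n k); rewrite lerDl mulr_ge0 ?(ltW (p_gt0 k))//.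
  by apply: sumr_ge0 => i _; rewrite mulr_ge0.
move=> /le_trans; apply.
have := ler_wpM2l (ltW (p_gt0 k)) (e_wsum n k).
by rewrite mulrA pE mul1r -(natr1 k); lra.
Qed.

End birth_chain_comparison.

(** * The path in the digital search tree *)

Section tree.
Implicit Types (t : {fset seq bool}) (s theta path : nat -> bool).

Lemma first_freeP t theta k :
  reflect (mkseq theta k \notin t /\
           forall j, (j < k)%N -> mkseq theta j \in t)
          (first_free t theta == k).
Proof.
rewrite /first_free; case: ex_minnP => m mN mmin.
apply: (iffP eqP) => [<-|[kN klt]].
  by split=> // j jm; apply: contraLR jm => /mmin; rewrite -leqNgt.
apply/eqP; rewrite eqn_leq mmin//= leqNgt; apply/negP => /klt.
by rewrite (negbTE mN).
Qed.

Lemma first_free_notin t theta : mkseq theta (first_free t theta) \notin t.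
Proof. by have /first_freeP[] := eqxx (first_free t theta). Qed.

Lemma lt_first_free t theta j :
  (j < first_free t theta)%N -> mkseq theta j \in t.
Proof. by have /first_freeP[_] := eqxx (first_free t theta); apply. Qed.

Lemma mkseq_eq_le s theta j k :
  (j <= k)%N -> mkseq s k = mkseq theta k -> mkseq s j = mkseq theta j.
Proof.
move=> jk E; have := congr1 (take j) E.
by rewrite /mkseq -!map_take !take_iota (minn_idPl jk).
Qed.

(** The node that is inserted hangs below nodes that are occupied already. *)
Lemma dst_prefix_closed (R : realType) (u : nat -> R) n theta k :
  mkseq theta k.+1 \in dst u n -> mkseq theta k \in dst u n.
Proof.
elim: n theta k => [|n IH] theta k; first by rewrite inE.
rewrite /= !in_fset1U => /orP[/eqP E|/IH ->]; last by rewrite orbT.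
set s := binary_digit (u n) in E *.
have ff : first_free (dst u n) s = k.+1.
  by have := congr1 size E; rewrite !size_mkseq.
rewrite ff in E.
by rewrite (mkseq_eq_le _ _ _ _ (leqnSn k) E) lt_first_free ?ff ?orbT.
Qed.

(** The first free node on [theta] moves only if the inserted node is that very
    node, that is, if the digits of the key follow [theta] down to it; by
    [dst_prefix_closed] it then moves by a single level. *)
Lemma first_free_dstS (R : realType) (u : nat -> R) n theta :
  let k := first_free (dst u n) theta in
  first_free (dst u n.+1) theta =
  if mkseq (binary_digit (u n)) k == mkseq theta k then k.+1 else k.
Proof.
move=> k; set s := binary_digit (u n).
have kN : mkseq theta k \notin dst u n := first_free_notin _ _.
apply/eqP; case: ifPn => [/eqP E|E]; apply/first_freeP => /=.
  have -> : first_free (dst u n) s = k.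
    apply/eqP/first_freeP; rewrite E; split=> // j jk.
    by rewrite (mkseq_eq_le _ _ _ _ (ltnW jk) E) lt_first_free.
  rewrite E; split=> [|j].
    rewrite in_fset1U negb_or; apply/andP; split.
      by apply/negP => /eqP/(congr1 size); rewrite !size_mkseq; lia.
    by apply/negP => /dst_prefix_closed; rewrite (negbTE kN).
  rewrite ltnS leq_eqVlt in_fset1U => /orP[/eqP ->|jk]; first by rewrite eqxx.
  by rewrite lt_first_free ?orbT.
split=> [|j jk]; last by rewrite in_fset1U lt_first_free ?orbT.
rewrite in_fset1U negb_or kN andbT -/s.
apply: contraNN E => /eqP E.
have ff : first_free (dst u n) s = k.
  by have := congr1 size E; rewrite !size_mkseq.
by rewrite -{1}ff -E.
Qed.

End tree.

(** * Digits of a uniform variable *)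

Lemma probability_setIr (R : realType) d (T : measurableType d) (mu : probability T R)
  (A I : set T) : measurable A -> measurable I -> mu I = 1%E ->
  mu A = mu (A `&` I).
Proof.
move=> mA mI I1.
have C0 : mu (~` I) = 0%E by rewrite probability_setC// I1 subee.
rewrite -[in LHS](setIT A) -(setUv I) setIUr measureU//.
- rewrite [X in (_ + X)%E](_ : _ = 0%E) ?adde0//.
  apply: (@subset_measure0 _ _ _ _ _ (~` I)) => //.
  + by apply: measurableI => //; exact: measurableC.
  + exact: measurableC.
- exact: measurableI.
- by apply: measurableI => //; exact: measurableC.
- by rewrite setIACA setICr setI0.
Qed.

Arguments probability_setIr {R d T mu A I}.

Lemma measurable_floor_preimage (R : realType) d (T : measurableType d) (g : T -> R)
  (B : set int) : measurable_fun setT g ->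
  measurable [set w | B (Num.floor (g w))].
Proof.
move=> mg.
have -> : [set w | B (Num.floor (g w))] =
    \bigcup_(j in B) (g @^-1` `[j%:~R, (j + 1)%:~R[).
  apply/seteqP; split => w /=.
    by move=> Bw; exists (Num.floor (g w)) => //=; rewrite in_itv/= floor_itv.
  by case=> j Bj /=; rewrite in_itv/= => /floor_def ->.
rewrite bigcup_mkcond; apply: countable_bigcupT_measurable => // j.
by case: ifP => // _; rewrite -[X in measurable X]setTI; exact: mg.
Qed.

Section digits.
Context (R : realType).
Implicit Types (x : R) (theta : nat -> bool).

(** The integer whose binary expansion is the prefix of length [k] of [theta]. *)
Fixpoint dyadic_prefix theta k : nat :=
  if k is j.+1 then (dyadic_prefix theta j).*2 + theta j else 0%N.

Lemma dyadic_prefix_lt theta k : (dyadic_prefix theta k < 2 ^ k)%N.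
Proof. by elim: k => //= k IH; rewrite expnS; case: (theta k) => /=; lia. Qed.

(** Numbers in [0, 1[ with a given prefix form a dyadic interval.  The point 1 is
    excluded: all its digits are 0. *)
Lemma mkseq_binary_digit theta k x : 0 <= x -> x < 1 ->
  (mkseq (binary_digit x) k == mkseq theta k) =
  (Num.truncn (2 ^+ k * x) == dyadic_prefix theta k).
Proof.
move=> x0 x1; elim: k => [|k IH].
  by rewrite expr0 mul1r /= truncn_eq// x0 x1.
rewrite !mkseqS eqseq_rcons IH.
rewrite /binary_digit /=.
set y := 2 ^+ k * x; have y0 : 0 <= y by rewrite mulr_ge0// exprn_ge0.
have -> : 2 ^+ k.+1 * x = 2 * y by rewrite exprS mulrA.
set s := Num.truncn (2 * y).
have /andP[sl su] : s%:R <= 2 * y < s.+1%:R by rewrite truncn_itv// mulr_ge0.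
have -> : Num.truncn y = s./2.
  apply: truncn_def; have := odd_double_half s; set h := s./2 => E.
  move: sl su; rewrite -E -addnS !natrD -muln2 natrM -[h.+1%:R]natr1.
  by case: (odd s) => /=; lra.
rewrite -[s in RHS]odd_double_half.
by case: (odd s); case: (theta k) => /=; lia.
Qed.

Lemma uniform_prob_itvco (a b : R) : 0 <= a -> a < b -> b <= 1 ->
  uniform_prob (@ltr01 R) `[a, b[ = (b - a)%:E.
Proof.
move=> a0 ab b1; rewrite /uniform_prob.
rewrite (eq_integral (cst 1%E)) => [|x].
  by rewrite integral_cst//= mul1e lebesgue_measure_itv/= lte_fin ab EFinB.
rewrite inE/= in_itv/= => /andP[ax xb]; rewrite /uniform_pdf.
by rewrite (le_trans a0 ax) (ltW (lt_le_trans xb b1)) subr0 invr1.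
Qed.

Definition matches theta k : set R :=
  [set x | mkseq (binary_digit x) k == mkseq theta k].

(** Off [0, 1[ the digits carry no meaning, so that measurability is obtained from
    that of the floor function and not from [mkseq_binary_digit]. *)
Lemma measurable_matches theta k : measurable (matches theta k).
Proof.
have dig j : measurable [set x : R | binary_digit x j = theta j].
  rewrite /binary_digit.
  have mf : measurable_fun setT (fun x : R => 2 ^+ j.+1 * x).
    exact: mulrl_measurable.
  have := measurable_floor_preimage _ _ _ _
    [set m | odd (if m is Posz i then i else 0%N) = theta j] mf.
  by congr measurable; apply/seteqP; split => x /=; rewrite truncEfloor.
elim: k => [|k IH].
  by rewrite (_ : matches _ _ = setT)//; apply/seteqP; split.
rewrite (_ : matches _ _ = matches theta k `&` [set x : R | binary_digit x k = theta k]).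
  exact: measurableI.
apply/seteqP; split => x; rewrite /matches /= !mkseqS eqseq_rcons.
  by move=> /andP[? /eqP].
by case=> -> /= ->.
Qed.

Lemma uniform_matches theta k :
  uniform_prob (@ltr01 R) (matches theta k) = (2 ^- k)%:E.
Proof.
set mu := uniform_prob _.
have mM := measurable_matches theta k.
have mI : measurable (`[0, 1[%classic : set R) by [].
have -> : mu (matches theta k) = mu (matches theta k `&` `[0, 1[).
  apply: (@probability_setIr _ _ _ (uniform_prob (@ltr01 R))) => //.
  by have := uniform_prob_itvco 0 1 (lexx _) ltr01 (lexx _); rewrite subr0.
set m := dyadic_prefix theta k.
have p0 : 0 < 2 ^+ k :> R by rewrite exprn_gt0.
have mlt : m.+1%:R <= 2 ^+ k :> R by rewrite -natrX ler_nat dyadic_prefix_lt.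
have -> : matches theta k `&` `[0, 1[ = `[m%:R / 2 ^+ k, m.+1%:R / 2 ^+ k[%classic.
  apply/seteqP; split => x /=; rewrite !in_itv/=.
    case=> + /andP[x0 x1]; rewrite /matches/= mkseq_binary_digit//.
    rewrite truncn_eq ?mulr_ge0 ?exprn_ge0// -/m => /andP[ml mu'].
    by rewrite ler_pdivrMr// ltr_pdivlMr// ![x * _]mulrC ml mu'.
  rewrite ler_pdivrMr// ltr_pdivlMr// ![x * _]mulrC => /andP[ml mu'].
  have x0 : 0 <= x by rewrite -(pmulr_rge0 _ p0); apply: le_trans ml.
  have x1 : x < 1.
    by rewrite -(ltr_pM2l p0) mulr1; exact: lt_le_trans mu' mlt.
  rewrite x0 x1; split => //; rewrite /matches/= mkseq_binary_digit//.
  by rewrite truncn_eq ?mulr_ge0 ?exprn_ge0// -/m ml mu'.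
rewrite /mu uniform_prob_itvco//.
- by rewrite -[m.+1%:R]natr1 mulrDl mul1r addrC addKr.
- by rewrite ltr_pM2r ?invr_gt0// ltr_nat.
- by rewrite ler_pdivrMr// mul1r.
Qed.

End digits.

(** * The law of the depth *)

(** The transition probabilities [2 ^- k] of the depth chain, as a recursion on its
    mass function. *)
Fixpoint depth_pmf (R : realType) (n k : nat) : R :=
  if n is m.+1 then
    (if k is j.+1 then 2 ^- j * depth_pmf R m j else 0)
    + (1 - 2 ^- k) * depth_pmf R m k
  else (k == 0%N)%:R.

Definition depth_tail (R : realType) (n k : nat) : R :=
  1 - \sum_(j < k) depth_pmf R n j.

Lemma depth_tail0 (R : realType) n : depth_tail R n 0 = 1.
Proof. by rewrite /depth_tail big_ord0 subr0. Qed.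

Lemma depth_tail_start (R : realType) k : depth_tail R 0 k.+1 = 0.
Proof.
by rewrite /depth_tail big_ord_recl/= big1 ?addr0 ?subrr.
Qed.

Lemma depth_pmfE (R : realType) n k :
  depth_pmf R n k = depth_tail R n k - depth_tail R n k.+1.
Proof. by rewrite /depth_tail big_ord_recr/=; ring. Qed.

Lemma depth_tailS (R : realType) n k :
  depth_tail R n.+1 k.+1 =
  (1 - 2 ^- k) * depth_tail R n k.+1 + 2 ^- k * depth_tail R n k.
Proof.
have -> : depth_tail R n.+1 k.+1 = depth_tail R n k.+1 + 2 ^- k * depth_pmf R n k.
  rewrite /depth_tail; elim: k => [|k IH].
    by rewrite !big_ord_recr !big_ord0/= expr0 invr1; ring.
  rewrite big_ord_recr [in RHS]big_ord_recr.
  rewrite opprD addrA IH /=; ring.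
by rewrite depth_pmfE; ring.
Qed.

Lemma depth_pmf_ge0 (R : realType) n k : 0 <= depth_pmf R n k.
Proof.
elim: n k => [|n IH] k; first by rewrite /=; case: eqP.
apply: addr_ge0; first by case: k => // k; rewrite mulr_ge0 ?invr_ge0 ?exprn_ge0.
by rewrite mulr_ge0// subr_ge0 invf_le1 ?exprn_gt0// exprn_ege1// ler1n.
Qed.

Section depth_law.
Context (R : realType) (d : measure_display) (Omega : measurableType d).
Context (P : probability Omega R) (U : nat -> {RV P >-> R}).
Variable theta : nat -> bool.
Hypothesis U_indep : mutually_independent U.
Hypothesis U_unif : forall n, has_law (U n) (uniform_prob (@ltr01 R)).

Let X n k : set Omega := [set w | free_depth U theta n w = k].
Let M n k : set Omega := U n @^-1` matches R theta k.

Let M_prob n k : P (M n k) = (2 ^- k)%:E.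
Proof. by have := U_unif n _ (measurable_matches R theta k); rewrite uniform_matches. Qed.

Let mM n k : measurable (M n k).
Proof.
rewrite -[M n k]setTI; apply: measurable_funP => //.
exact: measurable_matches.
Qed.

Let XS n k : X n.+1 k =
  (if k is j.+1 then X n j `&` M n j else set0) `|` (X n k `&` ~` M n k).
Proof.
apply/seteqP; split => w; rewrite /X /M /matches /free_depth /= first_free_dstS.
  case: ifPn => E <-; first by left; split.
  by right; split => //; exact/negP.
case=> [|[Xw /negP E]]; last by rewrite Xw (negbTE E).
by case: k => // j [-> ->].
Qed.

Lemma measurable_depth n k : measurable (X n k).
Proof.
elim: n k => [|n IH] k.
  have E w : free_depth U theta 0 w = 0%N.
    by apply/eqP/first_freeP; split=> //; rewrite inE.
  case: k => [|k].
    by rewrite (_ : X 0 0 = setT)//; apply/seteqP; split=> // w _; exact: E.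
  by rewrite (_ : X 0 k.+1 = set0)//; apply/seteqP; split=> // w; rewrite /X/= E.
rewrite XS; apply: measurableU.
  by case: k => // k; exact: measurableI.
by apply: measurableI => //; exact: measurableC.
Qed.

(** The events [U i \in B i] of later keys are carried along so that the Markov
    property follows by induction on [n]: the step absorbs the event that the key
    [n] matches, or does not match, the path down to the current level. *)
Lemma depth_indep n k (J : {fset nat}) (B : nat -> set R) :
  (forall i, measurable (B i)) -> (forall i, i \in J -> (n <= i)%N) ->
  P (X n k `&` \bigcap_(i in [set` J]) (U i @^-1` B i)) =
  ((depth_pmf R n k)%:E * \big[*%E/1%E]_(i <- J) P (U i @^-1` B i))%E.
Proof.
move=> mB; elim: n k J B mB => [|n IH] k J B mB Jn.
  have E w : free_depth U theta 0 w = 0%N.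
    by apply/eqP/first_freeP; split=> //; rewrite inE.
  case: k => [|k] /=.
    rewrite mul1e (_ : X 0 0 = setT) ?setTI; first exact: U_indep.
    by apply/seteqP; split=> // w _; exact: E.
  rewrite mul0e (_ : X 0 k.+1 = set0) ?set0I ?measure0//.
  by apply/seteqP; split=> // w; rewrite /X/= E.
set D := \bigcap_(i in _) _.
have nJ : n \notin J by apply/negP => /Jn; rewrite ltnn.
have mD : measurable D.
  apply: fin_bigcap_measurable => // i _.
  by rewrite -[X in measurable X]setTI; exact: measurable_funP.
have ext j (C : set R) : measurable C ->
    P (X n j `&` (U n @^-1` C `&` D)) =
    ((depth_pmf R n j)%:E * (P (U n @^-1` C) *
       \big[*%E/1%E]_(i <- J) P (U i @^-1` B i)))%E.
  move=> mC; pose B' i := if i == n then C else B i.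
  have B'n : B' n = C by rewrite /B' eqxx.
  have B'E i : i \in J -> B' i = B i.
    by rewrite /B'; case: eqP => // ->; rewrite (negbTE nJ).
  have := IH j (n |` J)%fset B'.
  rewrite big_fsetU1//= B'n.
  rewrite [\big[_/_]_(i <- J) P (U i @^-1` B' i)](eq_big_seq
    (fun i => P (U i @^-1` B i))); last by move=> i iJ; rewrite B'E.
  move=> <- ; last 2 first.
  - by move=> i; rewrite /B'; case: ifP.
  - by move=> i; rewrite in_fset1U => /orP[/eqP ->//|/Jn/ltnW].
  congr (P (_ `&` _)); apply/seteqP; split => w /=.
    move=> [Cw Dw] i /=; rewrite in_fset1U => /orP[/eqP ->|iJ].
      by rewrite B'n.
    by rewrite B'E//; exact: Dw.
  move=> H; split=> [|i /= iJ].
    by have := H n; rewrite /= B'n; apply; rewrite in_fset1U eqxx.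
  by rewrite -B'E//; apply: H; rewrite /= in_fset1U iJ orbT.
set Pi := \big[_/_]_(i <- J) _ in ext *.
have extM j : P (X n j `&` M n j `&` D) = ((2 ^- j * depth_pmf R n j)%:E * Pi)%E.
  rewrite -setIA (ext j (matches R theta j)); last exact: measurable_matches.
  rewrite [P (U n @^-1` _)](M_prob n j).
  rewrite muleA -EFinM; congr (_%:E * _)%E; exact: mulrC.
have extC j : P (X n j `&` ~` M n j `&` D) =
    (((1 - 2 ^- j) * depth_pmf R n j)%:E * Pi)%E.
  rewrite -setIA (_ : ~` M n j = U n @^-1` (~` matches R theta j))//.
  rewrite ext; last by apply: measurableC; exact: measurable_matches.
  rewrite (_ : P (U n @^-1` _) = 1 - (2 ^- j)%:E)%E; last first.
    exact: etrans (probability_setC P (mM n j)) (congr1 (fun x => 1 - x)%E (M_prob n j)).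
  rewrite muleA -EFinB -EFinM; congr (_%:E * _)%E; exact: mulrC.
rewrite XS setIUl measureU//=.
- rewrite extC; case: k => [|k]; first by rewrite set0I measure0 !add0e add0r.
  rewrite extM -ge0_muleDl ?lee_fin ?mulr_ge0 ?invr_ge0 ?exprn_ge0 ?depth_pmf_ge0//.
  by rewrite subr_ge0 invf_le1 ?exprn_gt0// exprn_ege1// ler1n.
- apply: measurableI => //; case: k => // k; apply: measurableI => //.
  exact: measurable_depth.
- do 2 apply: measurableI => //; first exact: measurable_depth.
  exact: measurableC.
- apply/seteqP; split => // w; case: k => [|k]; first by case=> -[[]].
  by move=> [[[Xk _] _] [[XS' _] _]]; move: XS'; rewrite /X/= Xk; lia.
Qed.

End depth_law.

(** * The weighted series and its measurability *)

Section weighted_series.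
Context (R : realType).
Implicit Types (y : nat -> R) (b c : R).

Definition wseries y : nat -> R := series (fun k => 2 ^- k * y k).

(** Independent exponential variables satisfy this for large [b], with probability
    close to 1.  Summation by the weights [2 ^- k] is then harmless, and positivity
    of the sum is what its logarithm needs. *)
Definition linear_growth b y := forall k, 0 < y k <= b * k.+1%:R.

Lemma sum_linear_geometric N : \sum_(k < N) 2 ^- k * k.+1%:R <= 4 :> R.
Proof.
suff -> : \sum_(k < N) 2 ^- k * k.+1%:R = 4 - (N%:R + 2) * (2 * 2 ^- N) :> R.
  by rewrite lerBlDr lerDl mulr_ge0 ?addr_ge0 ?mulr_ge0 ?invr_ge0 ?exprn_ge0.
elim: N => [|N IH]; first by rewrite big_ord0 expr0 invr1; ring.
rewrite big_ord_recr/= IH -[N.+1%:R]natr1 exprS invfM.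
by field; rewrite expf_neq0.
Qed.

Lemma linear_growth_ge0 b y : linear_growth b y -> 0 <= b.
Proof. by move=> /(_ 0%N); rewrite mulr1 => /andP[y0 /(lt_le_trans y0)/ltW]. Qed.

Lemma nondecreasing_wseries b y : linear_growth b y -> nondecreasing_seq (wseries y).
Proof.
move=> yb; apply: nondecreasing_series => k _ _.
by rewrite mulr_ge0 ?invr_ge0 ?exprn_ge0// ltW//; have /andP[] := yb k.
Qed.

Lemma wseries_le b y n : linear_growth b y -> wseries y n <= 4 * b.
Proof.
move=> yb; rewrite /wseries /series/= big_mkord.
apply: (@le_trans _ _ (b * \sum_(k < n) 2 ^- k * k.+1%:R)).
  rewrite mulr_sumr; apply: ler_sum => k _; rewrite mulrCA.
  by rewrite ler_pM2l ?invr_gt0 ?exprn_gt0//; have /andP[] := yb k.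
by rewrite mulrC ler_wpM2r ?sum_linear_geometric// (linear_growth_ge0 b y).
Qed.

Lemma is_cvg_wseries b y : linear_growth b y -> cvgn (wseries y).
Proof.
move=> yb; apply: nondecreasing_is_cvgn; first exact: nondecreasing_wseries yb.
by exists (4 * b) => _ [n _ <-]; exact: wseries_le.
Qed.

Lemma lim_wseries_le b y : linear_growth b y -> limn (wseries y) <= 4 * b.
Proof.
move=> yb; apply: limr_le; first exact: is_cvg_wseries yb.
by near=> n; exact: wseries_le.
Unshelve. all: by end_near. Qed.

Lemma lim_wseries_gt0 b y : linear_growth b y -> 0 < limn (wseries y).
Proof.
move=> yb; have /andP[y0 _] := yb 0%N; apply: (lt_le_trans y0).
have := nondecreasing_cvgn_le (nondecreasing_wseries b y yb) (is_cvg_wseries b y yb) 1%N.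
by rewrite /wseries /series/= big_nat1 expr0 invr1 mul1r.
Qed.

Definition behead_seq y : nat -> R := fun k => y k.+1.

Lemma linear_growth_behead b y :
  linear_growth b y -> linear_growth (2 * b) (behead_seq y).
Proof.
move=> yb k; have /andP[-> /le_trans] := yb k.+1; apply.
rewrite -mulrA mulrCA; apply: ler_wpM2l; first exact: linear_growth_ge0 yb.
by rewrite -natrM ler_nat; lia.
Qed.

Lemma lim_wseries_behead b y : linear_growth b y ->
  limn (wseries y) = y 0%N + limn (wseries (behead_seq y)) / 2.
Proof.
move=> yb; have cs := is_cvg_wseries _ _ (linear_growth_behead _ _ yb).
apply/cvg_lim => //; rewrite -(cvg_shiftS (wseries y)).
rewrite (_ : (fun n => _) = (fun n => y 0%N + wseries (behead_seq y) n / 2)); last first.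
  apply/funext => n; rewrite /wseries /series/= big_nat_recl// expr0 invr1 mul1r.
  congr (_ + _); rewrite mulr_suml; apply: eq_bigr => i _.
  by rewrite exprS invfM /behead_seq; ring.
apply: cvgD; first exact: cvg_cst.
by apply: cvgMl; exact: cs.
Qed.

End weighted_series.

Section measurable_limit.
Context (R : realType) (d : measure_display) (T : measurableType d).

(** Convergence is the Cauchy condition, a countable combination of events. *)
Lemma measurable_cvgn (h : nat -> T -> R) :
  (forall n, measurable_fun setT (h n)) -> measurable [set w | cvgn (h^~ w)].
Proof.
move=> mh.
have -> : [set w | cvgn (h^~ w)] = \bigcap_m \bigcup_N
    \bigcap_(i in [set i | (N <= i)%N]) \bigcap_(j in [set j | (N <= j)%N])
      [set w | `|h i w - h j w| < m.+1%:R^-1].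
  apply/seteqP; split => w /=.
    move=> /cvg_cauchy/cauchy_ballP cw m _.
    have m0 : 0 < m.+1%:R^-1 :> R by rewrite invr_gt0.
    have := cw _ m0 => -[[A B]] /= [[N1 _ H1] [N2 _ H2]] H.
    exists (maxn N1 N2) => // i /= Ni j /= Nj.
    apply: (H (h i w, h j w)); split => /=.
      by apply: H1 => /=; lia.
    by apply: H2 => /=; lia.
  move=> H; apply/cauchy_cvgP/cauchy_exP => e e0.
  pose m := Num.truncn e^-1.
  have me : m.+1%:R^-1 < e by rewrite invf_plt ?posrE// truncnS_gt.
  have [N _ HN] := H m I; exists (h N w); exists N => // j /= Nj.
  by apply: lt_trans me; exact: (HN N (leqnn N) j).
apply: bigcapT_measurable => m; apply: bigcupT_measurable => N.
apply: bigcap_measurable => [|i _]; first by exists N => /=.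
apply: bigcap_measurable => [|j _]; first by exists N => /=.
have mf : measurable_fun setT (fun w => `|h i w - h j w|).
  by apply: measurableT_comp => //; exact: measurable_funB.
rewrite (_ : [set w | _] = (fun w => `|h i w - h j w|) @^-1` `]-oo, m.+1%:R^-1[).
  by rewrite -[X in measurable X]setTI; exact: mf.
by apply/seteqP; split => w /=; rewrite in_itv.
Qed.

(** Where the sequence diverges, [limn] takes the default value 0 of the real line;
    multiplying by the indicator of the set of convergence gives a sequence that
    converges everywhere, with the same limit. *)
Lemma measurable_fun_limn (h : nat -> T -> R) :
  (forall n, measurable_fun setT (h n)) ->
  measurable_fun setT (fun w => limn (h^~ w)).
Proof.
move=> mh; set C := [set w | cvgn (h^~ w)].
have mC : measurable C by exact: measurable_cvgn.
apply: (@measurable_fun_cvg _ _ _ _ (fun n w => h n w * \1_C w)) => [n|w _].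
  by apply: measurable_funM => //; exact: measurable_indic.
rewrite indicE; have [wC|wC] := boolP (w \in C).
  rewrite (_ : (fun n => _) = h^~ w); last by apply/funext => n; rewrite mulr1.
  by move: wC; rewrite inE.
rewrite (_ : (fun n => _) = cst 0); last by apply/funext => n; rewrite mulr0.
rewrite dvgP; first exact: cvg_cst.
by move=> cw; move/negP: wC; apply; rewrite inE.
Qed.

End measurable_limit.

(** * Independent and identically distributed sequences *)

(** A family of random variables is studied through its law on the space of
    sequences: the sets below form a pi-system on which that law is a product. *)
Definition cylinder (R : realType) : set (set (nat -> R)) :=
  [set C | exists n, exists2 B : nat -> set R, (forall i, measurable (B i)) &
     C = [set y | forall i, (i < n)%N -> B i (y i)]].

Section sequence_space.
Context (R : realType).

Lemma measurable_coordinate i :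
  measurable_fun setT (fun y : g_sigma_algebraType (cylinder R) => y i).
Proof.
move=> _ B mB; rewrite setTI; apply: sub_sigma_algebra.
exists i.+1, (fun j => if j == i then B else setT) => [j|]; first by case: ifP.
apply/seteqP; split => y /=; first by move=> Biy j _; case: eqP => // ->.
by move=> /(_ i (ltnSn i)); rewrite eqxx.
Qed.

Lemma measurable_fun_sequence d (T : measurableType d)
  (f : T -> g_sigma_algebraType (cylinder R)) :
  (forall i, measurable_fun setT (fun w => f w i)) -> measurable_fun setT f.
Proof.
move=> mf; apply: (@measurability _ _ T (g_sigma_algebraType (cylinder R)) setT f
  (cylinder R)) => // _ [_ [n [B mB ->]] <-].
rewrite setTI (_ : _ @^-1` _ =
    \bigcap_(i in `I_n) ((fun w => f w i) @^-1` B i)); last first.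
  by apply/seteqP; split.
apply: fin_bigcap_measurable => // i _.
by rewrite -[X in measurable X]setTI; exact: mf.
Qed.

Lemma setI_closed_cylinder : setI_closed (cylinder R).
Proof.
move=> _ _ [n [B mB ->]] [m [C mC ->]]; exists (maxn n m).
exists (fun i => (if (i < n)%N then B i else setT) `&`
                 (if (i < m)%N then C i else setT)) => [i|].
  by apply: measurableI; case: ifP.
apply/seteqP; split => y /=.
  by case=> HB HC i _; split; case: ifPn => // ?; [exact: HB|exact: HC].
move=> H; split=> i il.
  by have [] := H i (leq_trans il (leq_maxl _ _)); rewrite il.
by have [] := H i (leq_trans il (leq_maxr _ _)); rewrite il.
Qed.

Lemma measurable_lim_wseries :
  measurable_fun setT (fun y : g_sigma_algebraType (cylinder R) =>
                         limn (wseries R y)).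
Proof.
apply: (measurable_fun_limn R _ (g_sigma_algebraType (cylinder R))
  (fun n y => wseries R y n)) => n.
rewrite /wseries /series/=; apply: measurable_sum => k.
apply: measurable_funM; first exact: measurable_cst.
exact: measurable_coordinate.
Qed.

End sequence_space.

Section iid_sequence.
Context (R : realType) (d : measure_display) (T : measurableType d).
Context (P : probability T R) (Y : nat -> {RV P >-> R}).
Hypothesis Y_indep : mutually_independent Y.
Hypothesis Y_iid : forall k B, measurable B ->
  P (Y k @^-1` B) = P (Y 0%N @^-1` B).

Lemma prefix_indep n (B : nat -> set R) : (forall i, measurable (B i)) ->
  P [set w | forall i, (i < n)%N -> B i (Y i w)] =
  (\big[*%E/1%E]_(i < n) P (Y 0%N @^-1` B i))%E.
Proof.
move=> mB; pose J := [fset i | i in iota 0 n]%fset.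
have JE i : (i \in J) = (i < n)%N by rewrite in_fset/= mem_iota.
have pJ : perm_eq (enum_fset J) (index_iota 0 n).
  apply: uniq_perm; rewrite ?fset_uniq ?iota_uniq// => i.
  by rewrite -[LHS]/(i \in J) JE mem_index_iota.
have := Y_indep J B mB.
rewrite (perm_big _ pJ)/= big_mkord => E.
rewrite (_ : [set w | _] = \bigcap_(i in [set` J]) (Y i @^-1` B i)).
  by rewrite E; apply: eq_bigr => i _; exact: Y_iid.
apply/seteqP; split => w /= H i; last by move=> il; apply: (H i); rewrite /= JE.
by rewrite /= JE; exact: H.
Qed.

Definition sample (w : T) : g_sigma_algebraType (cylinder R) :=
  fun i => Y i w.
Definition tail_sample (w : T) : g_sigma_algebraType (cylinder R) :=
  fun i => Y i.+1 w.

Lemma measurable_sample : measurable_fun setT sample.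
Proof. by apply: measurable_fun_sequence => i; exact: measurable_funP. Qed.

Lemma measurable_tail_sample : measurable_fun setT tail_sample.
Proof. by apply: measurable_fun_sequence => i; exact: measurable_funP. Qed.

(** Both sides are finite measures in [C], and they agree on cylinders.  This is at
    once the independence of [Y 0] from the later variables and the equality of the
    laws of the sequence and of its tail. *)
Lemma head_tail_indep (A : set R) (C : set (g_sigma_algebraType (cylinder R))) :
  measurable A -> measurable C ->
  P (tail_sample @^-1` C `&` Y 0%N @^-1` A) =
  (P (Y 0%N @^-1` A) * P (sample @^-1` C))%E.
Proof.
move=> mA.
have mYA : measurable (Y 0%N @^-1` A).
  by rewrite -[X in measurable X]setTI; exact: measurable_funP.
have r0 : 0 <= fine (P (Y 0%N @^-1` A)) by exact: fine_ge0.
pose m1 := mrestr P mYA.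
have rE : (fine (P (Y 0%N @^-1` A)))%:E = P (Y 0%N @^-1` A).
  by rewrite fineK// fin_num_measure.
pose m2 := mscale (NngNum r0) P.
move=> mC; rewrite -[P (Y 0%N @^-1` A)]rE.
apply: (@g_sigma_algebra_measure_unique _ R (g_sigma_algebraType (cylinder R))
  (cylinder R) _ (fun=> setT) _ _
  (pushforward m1 tail_sample) (pushforward m2 sample)) => //.
- by move=> X GX; exact: sub_sigma_algebra.
- move=> _; exists 0%N, (fun=> setT) => //.
  by apply/seteqP; split.
- by apply/seteqP; split=> // y _; exists 0%N.
- exact: measurable_tail_sample.
- exact: measurable_sample.
- exact: setI_closed_cylinder.
- move=> ? ? _ [n [B mB ->]].
  have mB' i : measurable (if i is j.+1 then B j else A) by case: i.
  have := prefix_indep n.+1 (fun i => if i is j.+1 then B j else A) mB'.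
  rewrite big_ord_recl/= -prefix_indep// => E.
  rewrite /pushforward /mscale /m1 /mrestr /= rE -E; congr (P _).
  apply/seteqP; split => w /=; first by case=> H Aw [|i] // il; exact: (H i il).
  by move=> H; split=> [i il|]; [exact: (H i.+1)|exact: (H 0%N)].
- move=> ? _; apply: le_lt_trans (ltry 1).
  exact: probability_le1 (measurableI _ _ measurableT mYA).
Qed.

End iid_sequence.

(** * The distribution function of the limit *)

Section exponential_increments.
Context (R : realType).

Definition expo_cdf (t : R) : R := Num.max 0 (1 - expR (- (2 * t))).

Lemma expo_cdf_le0 t : t <= 0 -> expo_cdf t = 0.
Proof.
move=> t0; rewrite /expo_cdf max_l// subr_le0 -expR0 ler_expR oppr_ge0.
by rewrite pmulr_rle0.
Qed.

Lemma expo_cdf_ge0E t : 0 <= t -> expo_cdf t = 1 - expR (- (2 * t)).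
Proof.
move=> t0; rewrite /expo_cdf max_r// subr_ge0 -expR0 ler_expR oppr_le0.
by rewrite mulr_ge0.
Qed.

Lemma expo_cdf_ge0 t : 0 <= expo_cdf t.
Proof. by rewrite /expo_cdf le_max lexx. Qed.

Lemma exponential_cdf t : exponential_prob 2 `]-oo, t] = (expo_cdf t)%:E.
Proof.
have E : exponential_prob 2 `]-oo, t] = exponential_prob 2 `[0, t].
  rewrite /exponential_prob.
  rewrite integral_mkcond [RHS]integral_mkcond; apply: eq_integral => x _.
  rewrite !patchE !mem_setE !in_itv/= /exponential_pdf patchE.
  by rewrite mem_setE in_itv/= andbT; case: (0 <= x); case: (x <= t).
rewrite E; have [t0|t0] := ltP 0 t.
  by rewrite exponential_prob_itv0c// mulNr -EFinB expo_cdf_ge0E// ltW.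
rewrite expo_cdf_le0//; have [->|tn0] := eqVneq t 0.
  by rewrite set_itv1 /exponential_prob integral_set1.
have tn : t < 0 by rewrite lt_neqAle tn0.
by rewrite set_itv_ge ?bnd_simp -?ltNge// /exponential_prob integral_set0.
Qed.

(** Lack of memory: for [0 <= a], [1 - expo_cdf (a + t)] is [expR (- (2 * t))] times
    [1 - expo_cdf a], and the factor is at least [1 - 2 * t]; for [a < 0 <= a + t]
    the density is at most 2. *)
Lemma expo_cdf_incr_le a t : 0 <= t ->
  expo_cdf (a + t) + 2 * t * expo_cdf a <=
  expo_cdf a + 2 * t * (0 <= a + t)%R%:R.
Proof.
move=> t0; have [at0|at0] := leP 0 (a + t); last first.
  by rewrite !expo_cdf_le0 ?mulr0 ?addr0//; lra.
rewrite mulr1 expo_cdf_ge0E//; have [a0|a0] := leP 0 a; last first.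
  rewrite (expo_cdf_le0 a) ?mulr0 ?addr0; last exact: ltW.
  by have := expR_ge1Dx (- (2 * (a + t))); lra.
rewrite expo_cdf_ge0E// mulrDr opprD expRD.
have := expR_ge1Dx (- (2 * t)); have := expR_gt0 (- (2 * a)).
set E := expR (- (2 * a)); set q := expR _ => E0 q1.
by nra.
Qed.

(** Here the factor [expR (- (2 * t))] is bounded above, by [(1 + 2 * t)^-1]. *)
Lemma expo_cdf_incr_ge a t : 0 <= t ->
  expo_cdf a + 2 * t * (0 <= a)%R%:R <=
  expo_cdf (a + t) + 2 * t * expo_cdf (a + t).
Proof.
move=> t0; have [a0|a0] := leP 0 a; last first.
  rewrite mulr0 addr0 (expo_cdf_le0 a); last exact: ltW.
  by rewrite addr_ge0 ?mulr_ge0 ?expo_cdf_ge0.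
rewrite mulr1 !expo_cdf_ge0E ?addr_ge0// mulrDr opprD expRD.
have q1 : expR (- (2 * t)) * (1 + 2 * t) <= 1.
  rewrite expRN mulrC ler_pdivrMr ?expR_gt0// mul1r.
  exact: expR_ge1Dx.
have := expR_gt0 (- (2 * a)); move: q1.
set E := expR (- (2 * a)); set q := expR _ => q1 E0.
by nra.
Qed.

End exponential_increments.

Section law_of_the_series.
Context (R : realType) (d : measure_display) (T : measurableType d).
Context (P : probability T R) (Y : nat -> {RV P >-> R}).
Hypothesis Y_indep : mutually_independent Y.
Hypothesis Y_exp : forall k, has_law (Y k) (exponential_prob 2).

Let S' (w : T) : R := limn (wseries R (fun k => Y k.+1 w)).

Lemma measurable_S_infty : measurable_fun setT (S_infty Y).
Proof.
exact: measurableT_comp (measurable_lim_wseries R) (measurable_sample R d T P Y).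
Qed.

Let measurable_S' : measurable_fun setT S'.
Proof.
exact: measurableT_comp (measurable_lim_wseries R)
  (measurable_tail_sample R d T P Y).
Qed.

Let Y_cdf k t : P (Y k @^-1` `]-oo, t]) = (expo_cdf R t)%:E.
Proof. by rewrite [LHS]Y_exp// exponential_cdf. Qed.

Let mY k B : measurable B -> measurable (Y k @^-1` B).
Proof. by move=> mB; rewrite -[X in measurable X]setTI; exact: measurable_funP. Qed.

Let growth_event b : set T := [set w | linear_growth R b (fun k => Y k w)].

Let growth_eventE b : growth_event b = \bigcap_k (Y k @^-1` `]0, b * k.+1%:R]).
Proof.
apply/seteqP; split => w H k; first by move=> _; have := H k; rewrite /= in_itv.
by have := H k I; rewrite /= in_itv.
Qed.

Let measurable_growth b : measurable (growth_event b).
Proof. by rewrite growth_eventE; apply: bigcapT_measurable => k; exact: mY. Qed.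

Let bad_coordinate k (c : R) : 0 <= c ->
  (P (~` (Y k @^-1` `]0%R, c])) <= (expR (- (2 * c)))%R%:E)%E.
Proof.
move=> c0.
have hC : P (~` (Y k @^-1` `]-oo, c])) = (expR (- (2 * c)))%:E.
  rewrite probability_setC; last exact: mY.
  rewrite [P (Y k @^-1` _)](Y_cdf k c) expo_cdf_ge0E// -EFinB.
  by congr _%:E; ring.
have Z : P (Y k @^-1` `]-oo, 0]) = 0%E by rewrite Y_cdf expo_cdf_le0.
rewrite -hC -[leRHS]add0e -Z.
apply: le_trans (measureU2 _ _ _); [|exact: mY|apply: measurableC; exact: mY].
apply: le_measure; rewrite ?inE.
- by apply: measurableC; exact: mY.
- by apply: measurableU; [exact: mY|apply: measurableC; exact: mY].
- move=> w /=; rewrite !in_itv/= => /negP; rewrite negb_and -!leNgt -ltNge.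
  by move=> /orP[|H]; [left|right; apply/negP; rewrite -ltNge].
Qed.

(* The union bound gives a geometric series of ratio [q]; for [2^-1 <= q] the
   bound is at least 1. *)
Let bad_le (b : R) : 0 <= b ->
  (P (~` growth_event b) <= (2 * expR (- (2 * b)))%R%:E)%E.
Proof.
move=> b0; set q := expR (- (2 * b)).
have [q2|q2] := leP 2^-1 q.
  apply: (@le_trans _ _ 1%E).
    by apply: probability_le1; exact: measurableC.
  by rewrite lee_fin; lra.
have q0 : 0 < q := expR_gt0 _.
rewrite growth_eventE setC_bigcap.
apply: (@le_trans _ _ (\sum_(0 <= k <oo) P (~` (Y k @^-1` `]0%R, (b * k.+1%:R)%R])))%E).
  apply: measure_sigma_subadditive => //.
  - by move=> k; apply: measurableC; exact: mY.
  - by apply: bigcupT_measurable => k; apply: measurableC; exact: mY.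
apply: lime_le; first by apply: is_cvg_nneseries.
near=> n.
apply: (@le_trans _ _ (\sum_(0 <= k < n) (q ^+ k.+1)%:E)%E).
  apply: lee_sum => k _; apply: le_trans (bad_coordinate _ _ _) _.
    by rewrite mulr_ge0.
  rewrite lee_fin /q -expRM_natl (_ : _ * - (2 * b) = - (2 * (b * k.+1%:R)))//.
  by ring.
rewrite sumEFin lee_fin big_mkord.
have E m : (1 - q) * \sum_(k < m) q ^+ k.+1 = q * (1 - q ^+ m).
  elim: m => [|m IH]; first by rewrite big_ord0 expr0; ring.
  by rewrite big_ord_recr/= mulrDr IH !exprS; ring.
have S0 : 0 <= \sum_(k < n) q ^+ k.+1.
  by apply: sumr_ge0 => k _; rewrite exprn_ge0// ltW.
have : 0 <= q ^+ n by rewrite exprn_ge0// ltW.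
by have := E n; nra.
Unshelve. all: by end_near. Qed.

Definition S_cdf (x : R) : R := fine (P [set w | S_infty Y w <= x]).

Let G := \bigcup_n (growth_event n%:R).

Let mG : measurable G.
Proof. exact: bigcupT_measurable. Qed.

Let PG : P G = 1%E.
Proof.
have : P (~` G) = 0%E.
  apply/eqP; rewrite eq_le measure_ge0 andbT leNgt; apply/negP => G0.
  have Gf : P (~` G) = (fine (P (~` G)))%:E.
    by rewrite fineK// fin_num_measure//; exact: measurableC.
  move: G0; rewrite Gf lte_fin; set r := fine _ in Gf * => r0.
  pose n := Num.truncn r^-1.
  have rn : 1 < r * n.+1%:R by rewrite mulrC -ltr_pdivrMr// div1r truncnS_gt.
  have := bad_le n.+1%:R (ler0n _ _).
  have : (P (~` G) <= P (~` growth_event n.+1%:R))%E.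
    apply: le_measure; rewrite ?inE; [exact: measurableC|exact: measurableC|].
    by apply: subsetC => w gw; exists n.+1.
  move=> /le_trans h /h; rewrite Gf lee_fin.
  have : expR (- (2 * n.+1%:R)) * (1 + 2 * n.+1%:R) <= 1 :> R.
    rewrite expRN mulrC ler_pdivrMr ?expR_gt0// mul1r; exact: expR_ge1Dx.
  have := expR_gt0 (- (2 * n.+1%:R) : R); set E := expR _.
  by nra.
rewrite probability_setC// => /eqP; rewrite sube_eq ?fin_num_measure// add0e.
by move=> /eqP <-.
Qed.

Lemma S_infty_gt0_as : P [set w | 0 < S_infty Y w] = 1%E.
Proof.
have m0 : measurable [set w | 0 < S_infty Y w].
  rewrite (_ : [set w | _] = S_infty Y @^-1` `]0, +oo[).
    by rewrite -[X in measurable X]setTI; exact: measurable_S_infty.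
  by apply/seteqP; split => w /=; rewrite in_itv/= andbT.
rewrite (probability_setIr m0 mG PG) (_ : _ `&` G = G)//.
apply/seteqP; split => w; first by case.
by move=> Gw; split=> //; case: Gw => n _; exact: lim_wseries_gt0.
Qed.

Let mS x : measurable [set w | S_infty Y w <= x].
Proof.
rewrite (_ : [set w | _] = S_infty Y @^-1` `]-oo, x]).
  by rewrite -[X in measurable X]setTI; exact: measurable_S_infty.
by apply/seteqP; split => w /=; rewrite in_itv.
Qed.

Let S_cdfE x : (S_cdf x)%:E = P [set w | S_infty Y w <= x].
Proof. by rewrite fineK// fin_num_measure. Qed.

(** If [Y k <= (x / 4) * (k + 1)] for all [k], then the series is at most [x]. *)
Lemma S_cdf_tail x : 0 <= x -> 1 - S_cdf x <= 2 * expR (- (x / 2)).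
Proof.
move=> x0; have x4 : 0 <= x / 4 by rewrite divr_ge0.
rewrite -lee_fin EFinB S_cdfE -probability_setC//.
apply: (@le_trans _ _ (P (~` growth_event (x / 4)))).
  apply: le_measure; rewrite ?inE; [exact: measurableC|exact: measurableC|].
  apply: subsetC => w gw /=; apply: le_trans (lim_wseries_le _ _ _ gw) _.
  by rewrite mulrC divfK.
apply: le_trans (bad_le _ x4) _; rewrite lee_fin.
by rewrite (_ : 2 * (x / 4) = x / 2)//; field.
Qed.

Lemma S_cdf_le1 x : S_cdf x <= 1.
Proof. by rewrite -lee_fin S_cdfE; exact: probability_le1. Qed.

Lemma S_cdf_nd : {homo S_cdf : x y / x <= y}.
Proof.
move=> x y xy; rewrite -lee_fin !S_cdfE; apply: le_measure; rewrite ?inE//.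
by move=> w /= /le_trans; apply.
Qed.

Lemma S_cdf0 : S_cdf 0 = 0.
Proof.
apply/EFin_inj; rewrite S_cdfE.
rewrite (_ : [set w | _] = ~` [set w | 0 < S_infty Y w]); last first.
  by apply/seteqP; split => w /=; [rewrite ltNge => ->|move/negP; rewrite -leNgt].
rewrite probability_setC ?S_infty_gt0_as ?subee//.
rewrite (_ : [set w | _] = ~` [set w | S_infty Y w <= 0]).
  exact: measurableC.
by apply/seteqP; split => w /=; rewrite ltNge => /negP.
Qed.

Let S_pack : {mfun T >-> R} :=
  HB.pack (S_infty Y) (isMeasurableFun.Build _ _ _ _ (S_infty Y) measurable_S_infty).

Let mu := distribution P S_pack.

Let mphi x : measurable_fun setT (fun v : R => expo_cdf R (x - v / 2)).
Proof.
apply: measurable_maxr; first exact: measurable_cst.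
apply: measurable_funB; first exact: measurable_cst.
apply: measurableT_comp => //; apply: measurableT_comp => //.
apply: measurable_funM; first exact: measurable_cst.
apply: measurable_funB; first exact: measurable_cst.
by apply: measurable_funM => //; exact: measurable_cst.
Qed.

(* [S_infty = Y 0 + S' / 2] almost surely; the joint law of [S'] and [Y 0] is a
   product by [head_tail_indep], and [S'] has the law of [S_infty]. *)
Let convolution (x : R) :
  (S_cdf x)%:E = (\int[mu]_v (expo_cdf R (x - v / 2))%:E)%E.
Proof.
pose X : set (R * R) := [set vu | vu.2 + vu.1 / 2 <= x].
have mX : measurable X.
  rewrite (_ : X = (fun vu : R * R => vu.2 + vu.1 / 2) @^-1` `]-oo, x]).
    rewrite -[X in measurable X]setTI.
    have : measurable_fun setT (fun vu : R * R => vu.2 + vu.1 / 2).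
      apply: measurable_funD => //.
      by apply: measurable_funM => //; exact: measurable_cst.
    by apply => //.
  by apply/seteqP; split => vu /=; rewrite in_itv.
pose J w : R * R := (S' w, Y 0%N w).
have mJ : measurable_fun setT J by apply/measurable_fun_pairP; split.
have J_prod : (mu \x distribution P (Y 0%N))%E X = pushforward P J X.
  apply: (@product_measure_unique _ _ _ _ R mu (distribution P (Y 0%N))
    (pushforward P J)) => // A B mA mB.
  rewrite /pushforward/= /mu /distribution /pushforward muleC.
  have mC : measurable
    ((fun y : g_sigma_algebraType (cylinder R) => limn (wseries R y)) @^-1` A).
    by rewrite -[X in measurable X]setTI; exact: measurable_lim_wseries.
  apply: etrans (head_tail_indep R d T P Y Y_indep _ _ _ mB mC) => //.
  by move=> k C mC'; rewrite [LHS]Y_exp// [RHS]Y_exp.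
have -> : (S_cdf x)%:E = pushforward P J X.
  rewrite S_cdfE /pushforward.
  have mJX : measurable (J @^-1` X).
    by rewrite -[X in measurable X]setTI; exact: mJ.
  rewrite (probability_setIr (mS x) mG PG).
  rewrite (probability_setIr mJX mG PG).
  congr (P _); apply/seteqP; split => w [+ Gw]; have [n _ gw] := Gw.
    by rewrite /= /S_infty (lim_wseries_behead _ _ _ gw) => H; split.
  by rewrite /X /J /S' /= -(lim_wseries_behead _ _ _ gw) => H; split.
rewrite -J_prod /product_measure1; apply: eq_integral => v _ /=.
rewrite -(Y_cdf 0%N) /distribution /pushforward; congr (P _).
apply/seteqP; split => w /=.
  by rewrite /xsection/= inE in_itv/= /X/= lerBrDr.
by rewrite /xsection/= inE in_itv/= /X/= lerBrDr.
Qed.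

Let S_cdf_indic (z : R) :
  (S_cdf z)%:E = (\int[mu]_v ((v <= z)%R%:R)%:E)%E.
Proof.
rewrite S_cdfE.
rewrite (eq_integral (fun v => (\1_(`]-oo, z]) v)%:E)); last first.
  by move=> v _; rewrite indicE mem_setE in_itv.
rewrite integral_indic// setIT /mu /distribution /pushforward; congr (P _).
Qed.

Let mindic (z : R) : measurable_fun setT (fun v : R => (v <= z)%R%:R : R).
Proof.
rewrite (_ : (fun _ => _) = \1_(`]-oo, z])); first exact: measurable_indic.
by apply/funext => v; rewrite indicE mem_setE in_itv.
Qed.

Let combine (f g : R -> R) (a b c : R) : 0 <= c ->
  (forall v, 0 <= f v) -> (forall v, 0 <= g v) ->
  measurable_fun setT f -> measurable_fun setT g ->
  a%:E = (\int[mu]_v (f v)%:E)%E -> b%:E = (\int[mu]_v (g v)%:E)%E ->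
  (a + c * b)%:E = (\int[mu]_v (f v + c * g v)%:E)%E.
Proof.
move=> c0 f0 g0 mf mg fa gb; rewrite EFinD EFinM fa gb.
rewrite -ge0_integralZl//; last 2 first.
- exact/measurable_EFinP.
- by move=> v _; rewrite lee_fin.
rewrite -ge0_integralD//.
- by move=> v _; rewrite lee_fin.
- exact/measurable_EFinP.
- by move=> v _; rewrite -EFinM lee_fin mulr_ge0.
- apply/measurable_EFinP; apply: measurable_funM => //.
Qed.

Let combine_le (f g f' g' : R -> R) (a b a' b' c : R) : 0 <= c ->
  (forall v, 0 <= f v) -> (forall v, 0 <= g v) ->
  (forall v, 0 <= f' v) -> (forall v, 0 <= g' v) ->
  measurable_fun setT f -> measurable_fun setT g ->
  measurable_fun setT f' -> measurable_fun setT g' ->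
  a%:E = (\int[mu]_v (f v)%:E)%E -> b%:E = (\int[mu]_v (g v)%:E)%E ->
  a'%:E = (\int[mu]_v (f' v)%:E)%E -> b'%:E = (\int[mu]_v (g' v)%:E)%E ->
  (forall v, f v + c * g v <= f' v + c * g' v) ->
  a + c * b <= a' + c * b'.
Proof.
move=> c0 f0 g0 f0' g0' mf mg mf' mg' fa gb fa' gb' H.
rewrite -lee_fin (combine f g)// (combine f' g')//.
apply: ge0_le_integral => //.
- by move=> v _; rewrite lee_fin addr_ge0 ?mulr_ge0.
- by apply/measurable_EFinP; apply: measurable_funD => //; apply: measurable_funM.
- by apply/measurable_EFinP; apply: measurable_funD => //; apply: measurable_funM.
- by move=> v _; rewrite lee_fin.
Qed.

(** [expo_cdf_incr_le] at [a = x - v / 2], integrated over the law of [S'].  The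
    indicator of [0 <= a + t] is that of [v <= 2 * (x + t)] and contributes the
    doubled argument. *)
Lemma S_cdf_incr_le x t : 0 <= x -> 0 <= t ->
  S_cdf (x + t) - S_cdf x <= 2 * t * (S_cdf (2 * (x + t)) - S_cdf x).
Proof.
move=> _ t0.
suff : S_cdf (x + t) + 2 * t * S_cdf x <= S_cdf x + 2 * t * S_cdf (2 * (x + t)).
  by lra.
apply: (combine_le _ _ _ _ _ _ _ _ (2 * t) _ _ _ _ _ (mphi (x + t)) (mphi x)
  (mphi x) (mindic (2 * (x + t))) (convolution _) (convolution _)
  (convolution _) (S_cdf_indic _)) => // [|v|v|v|v].
- by rewrite mulr_ge0.
- exact: expo_cdf_ge0.
- exact: expo_cdf_ge0.
- exact: expo_cdf_ge0.
have := expo_cdf_incr_le R (x - v / 2) t t0.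
rewrite (_ : x - v / 2 + t = x + t - v / 2); last by ring.
by rewrite subr_ge0 ler_pdivrMr// [(x + t) * 2]mulrC.
Qed.

Lemma S_cdf_incr_ge x t : 0 <= x -> 0 <= t ->
  2 * t * (S_cdf (2 * x) - S_cdf (x + t)) <= S_cdf (x + t) - S_cdf x.
Proof.
move=> _ t0.
suff : S_cdf x + 2 * t * S_cdf (2 * x) <=
       S_cdf (x + t) + 2 * t * S_cdf (x + t) by lra.
apply: (combine_le _ _ _ _ _ _ _ _ (2 * t) _ _ _ _ _ (mphi x) (mindic (2 * x))
  (mphi (x + t)) (mphi (x + t)) (convolution _) (S_cdf_indic _)
  (convolution _) (convolution _)) => // [|v|v|v|v].
- by rewrite mulr_ge0.
- exact: expo_cdf_ge0.
- exact: expo_cdf_ge0.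
- exact: expo_cdf_ge0.
have := expo_cdf_incr_ge R (x - v / 2) t t0.
rewrite (_ : x - v / 2 + t = x + t - v / 2); last by ring.
by rewrite subr_ge0 ler_pdivrMr// [x * 2]mulrC.
Qed.

End law_of_the_series.

(** * Total variation over a window of levels *)

Section total_variation.
Context (R : realType).

Section window.
Context (d : measure_display) (T : measurableType d).
Context (P : probability T R) (W : T -> int).
Hypothesis mW : forall A : set int, measurable [set w | A (W w)].

Definition int_pmf (k : nat) : R := fine (P [set w | W w = k%:Z]).

Let window (A : set int) K := [set w | A (W w) /\ exists2 k, (k < K)%N & W w = k%:Z].

Let measurable_window A K : measurable (window A K).
Proof. exact: (mW [set j | A j /\ exists2 k, (k < K)%N & j = k%:Z]). Qed.

Let fin_P A : P [set w | A (W w)] = (fine (P [set w | A (W w)]))%:E.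
Proof. by rewrite fineK// fin_num_measure. Qed.

Let P_window A K :
  P (window A K) = (\sum_(k < K) (`[< A k%:Z >] : nat)%:R * int_pmf k)%:E.
Proof.
elim: K => [|K IH].
  rewrite big_ord0 (_ : window A 0 = set0) ?measure0//.
  by apply/seteqP; split=> // w [_ []].
rewrite big_ord_recr EFinD -IH/=.
have -> : ((`[< A K%:Z >] : nat)%:R * int_pmf K)%:E =
    P [set w | A (W w) /\ W w = K%:Z].
  case: asboolP => AK /=.
    rewrite mul1r [RHS](fin_P [set j | A j /\ j = K%:Z]) /int_pmf; congr (fine (P _))%:E.
    by apply/seteqP; split => w /=; [move=> E; rewrite E|case].
  rewrite mul0r (_ : [set w | _] = set0) ?measure0//.
  by apply/seteqP; split => // w /= [+ E]; rewrite E.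
rewrite -measureU//.
- congr (P _); apply/seteqP; split => w /=.
    case=> Aw [k]; rewrite ltnS leq_eqVlt => /orP[/eqP ->|kK] E; first by right.
    by left; split=> //; exists k.
  case=> [[Aw [k kK E]]|[Aw E]]; split=> //; first by exists k => //; exact: ltnW.
  by exists K.
- exact: (mW [set j | A j /\ j = K%:Z]).
- apply/seteqP; split => // w /= [[_ [k kK ->]] [_ []]] kE.
  by move: kK; rewrite kE ltnn.
Qed.

Lemma window_bounds (A : set int) K :
  let s := \sum_(k < K) (`[< A k%:Z >] : nat)%:R * int_pmf k in
  s <= fine (P [set w | A (W w)]) <= s + (1 - \sum_(k < K) int_pmf k).
Proof.
rewrite /=; set s := (X in X <= _ <= _).
rewrite -!lee_fin -fin_P; apply/andP; split.
  by rewrite -P_window; apply: le_measure; rewrite ?inE// => w [].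
have -> : 1 - \sum_(k < K) int_pmf k =
          1 - \sum_(k < K) (`[< setT k%:Z >] : nat)%:R * int_pmf k.
  by congr (1 - _); apply: eq_bigr => k _; rewrite asboolT// mul1r.
rewrite EFinD EFinB -!P_window -probability_setC//.
apply: le_trans (measureU2 _ _ _) => //; last exact: measurableC.
apply: le_measure; rewrite ?inE//; first by apply: measurableU => //; exact: measurableC.
move=> w Aw; have [[_ H]|H] := pselect (window setT K w); last by right.
by left; split.
Qed.

End window.

(** Only the mass of the levels in [0, K[ is compared; the mass of each law outside
    the window is accounted for in full, wherever it lies in [int]. *)
Lemma total_variation_window (d d' : measure_display) (T : measurableType d)
  (T' : measurableType d') (P : probability T R) (P' : probability T' R)
  (W : T -> int) (W' : T' -> int)
  (mW : forall A : set int, measurable [set w | A (W w)])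
  (mW' : forall A : set int, measurable [set w | A (W' w)])
  (A : set int) K :
  `|fine (P [set w | A (W w)]) - fine (P' [set w | A (W' w)])| <=
  \sum_(k < K) `|int_pmf _ _ P W k - int_pmf _ _ P' W' k| +
  (1 - \sum_(k < K) int_pmf _ _ P W k) + (1 - \sum_(k < K) int_pmf _ _ P' W' k).
Proof.
have /= := window_bounds _ _ P W mW A K.
have /= := window_bounds _ _ P' W' mW' A K.
set s' := (X in X <= _ <= _); move=> /andP[l' u'].
set s := (X in X <= _ <= _); move=> /andP[l u].
rewrite -/s in u; rewrite -/s' in u'.
have ss : `|s - s'| <= \sum_(k < K) `|int_pmf _ _ P W k - int_pmf _ _ P' W' k|.
  rewrite /s /s' -sumrB; apply: le_trans (ler_norm_sum _ _ _) _.
  apply: ler_sum => k _; rewrite -mulrBr normrM ler_piMl//.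
  by case: asboolP => _; rewrite ?normr1 ?normr0.
move: ss; rewrite ler_norml => /andP[s1 s2].
by rewrite ler_norml; apply/andP; split; lra.
Qed.

End total_variation.

Section rate.
Context (R : realType).

Lemma log2_ge_pow (x : R) k : 0 < x -> (k%:R <= log2 x) = (2 ^+ k <= x).
Proof.
move=> x0; rewrite /log2 ler_pdivlMr ?ln_gt0 ?ltr1n//.
rewrite mulr_natl -lnXn ?ltr0n// ler_ln ?posrE ?exprn_gt0//.
Qed.

Lemma log2_div (x y : R) : 0 < x -> 0 < y -> log2 (x / y) = log2 x - log2 y.
Proof. by move=> x0 y0; rewrite /log2 ln_div ?posrE// mulrBl. Qed.

Lemma ln_le_powR (x e : R) : 0 < x -> 0 < e -> ln x <= e^-1 * x `^ e.
Proof.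
move=> x0 e0; rewrite mulrC ler_pdivlMr// mulrC -ln_powR.
by apply: ltW; apply: ln_sublinear; rewrite powR_gt0.
Qed.

End rate.

(** * The rate of approximation *)

Section two_chains.
Context (R : realType) (d : measure_display) (Omega : measurableType d).
Context (P : probability Omega R) (U : nat -> {RV P >-> R}).
Hypothesis U_indep : mutually_independent U.
Hypothesis U_unif : forall n, has_law (U n) (uniform_prob (@ltr01 R)).
Variable theta : nat -> bool.
Context (d' : measure_display) (Omega' : measurableType d').
Context (P' : probability Omega' R) (Y : nat -> {RV P' >-> R}).
Hypothesis Y_indep : mutually_independent Y.
Hypothesis Y_exp : forall k, has_law (Y k) (exponential_prob 2).

Let X n (w : Omega) : int := (free_depth U theta n w)%:Z.
Let Z n (w : Omega') : int := Num.floor (log2 n%:R - log2 (S_infty Y w)).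
Let F := S_cdf R d' Omega' P' Y.
Let H n k := F (n%:R / 2 ^+ k).
Let h n k := depth_tail R n k.

Let mX n (A : set int) : measurable [set w | A (X n w)].
Proof.
rewrite (_ : [set w | _] =
    \bigcup_(k in [set k | A k%:Z]) [set w | free_depth U theta n w = k]).
  by apply: bigcup_measurable => k _; exact: measurable_depth.
apply/seteqP; split => w /=; first by move=> AX; exists (free_depth U theta n w).
by case=> k /= Ak Xk; rewrite /X Xk.
Qed.

Let X_pmf n k : int_pmf R d Omega P (X n) k = h n k - h n k.+1.
Proof.
rewrite -depth_pmfE /int_pmf.
have := depth_indep R d Omega P U theta U_indep U_unif n k fset0 (fun=> setT).
have no_index i : i \in (fset0 : {fset nat}) -> (n <= i)%N by rewrite inE.
rewrite big_seq_fset0 mule1 => /(_ (fun=> measurableT) no_index) E.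
apply/EFin_inj; rewrite -E fineK; last first.
  by rewrite fin_num_measure//; exact: (mX n [set j | j = k%:Z]).
congr (P _); apply/seteqP; split => w /=.
  by rewrite /X => -[Xk]; split=> // i.
by case; rewrite /X => ->.
Qed.

Let X_window n K : 1 - \sum_(k < K) int_pmf R d Omega P (X n) k = h n K.
Proof.
rewrite /h /depth_tail; congr (1 - _); apply: eq_bigr => k _.
by rewrite X_pmf depth_pmfE.
Qed.

Let measurable_log2 : measurable_fun setT (fun w => log2 (S_infty Y w)).
Proof.
apply: measurable_funM; last exact: measurable_cst.
by apply: measurableT_comp; [exact: measurable_ln|exact: measurable_S_infty].
Qed.

Let mZ n (A : set int) : measurable [set w | A (Z n w)].
Proof.
apply: measurable_floor_preimage.
by apply: measurable_funB; [exact: measurable_cst|exact: measurable_log2].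
Qed.

Let Z_ge n k w : (0 < n)%N -> 0 < S_infty Y w ->
  (k%:Z <= Z n w) = (S_infty Y w <= n%:R / 2 ^+ k).
Proof.
move=> n0 S0; rewrite /Z -log2_div ?ltr0n// floor_ge_int.
rewrite -[k%:Z%:~R]/(k%:R) log2_ge_pow ?divr_gt0 ?ltr0n//.
by rewrite ler_pdivlMr// [RHS]ler_pdivlMr ?exprn_gt0// mulrC.
Qed.

Let Z_pmf n k : (0 < n)%N -> int_pmf R d' Omega' P' (Z n) k = H n k - H n k.+1.
Proof.
move=> n0; apply/EFin_inj.
have mS x : measurable [set w | S_infty Y w <= x].
  rewrite (_ : [set w | _] = S_infty Y @^-1` `]-oo, x]).
    by rewrite -[X in measurable X]setTI; exact: measurable_S_infty.
  by apply/seteqP; split => w /=; rewrite in_itv.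
have m0 : measurable [set w | 0 < S_infty Y w].
  rewrite (_ : [set w | _] = ~` [set w | S_infty Y w <= 0]).
    exact: measurableC.
  by apply/seteqP; split => w /=; rewrite ltNge => /negP.
have le_H : [set w | S_infty Y w <= n%:R / 2 ^+ k.+1] `<=`
            [set w | S_infty Y w <= n%:R / 2 ^+ k].
  move=> w /= /le_trans; apply; rewrite ler_pM2l ?ltr0n//.
  by rewrite lef_pV2 ?posrE ?exprn_gt0// ler_eXn2l// ltr1n.
have FE x : (F x)%:E = P' [set w | S_infty Y w <= x].
  by rewrite fineK// fin_num_measure.
rewrite /int_pmf fineK; last first.
  by rewrite fin_num_measure//; exact: (mZ n [set j | j = k%:Z]).
rewrite EFinB !FE.
rewrite -[in X in (_ - X)%E](setIidr le_H) -measureD//; last first.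
  by rewrite -ge0_fin_numE ?fin_num_measure.
have pos := S_infty_gt0_as R d' Omega' P' Y Y_exp.
rewrite (probability_setIr (mZ n [set j | j = k%:Z]) m0 pos).
rewrite [RHS](probability_setIr _ m0 pos); last exact: measurableD.
congr (P' _); apply/seteqP; split => w /= [+ S0]; rewrite -!(Z_ge n _ w n0 S0).
  by move=> Zk; split=> //; rewrite Zk; split => //; apply/negP; lia.
by case=> Z1 /negP Z2; split=> //; lia.
Qed.

Let Z_window n K : (0 < n)%N ->
  1 - \sum_(k < K) int_pmf R d' Omega' P' (Z n) k = (1 - H n 0) + H n K.
Proof.
move=> n0; elim: K => [|K IH]; first by rewrite big_ord0; ring.
by rewrite big_ord_recr/= Z_pmf// opprD addrA IH; ring.
Qed.

Let level_error n k : n%:R * `|h n k - H n k| <= 8 * k%:R + 64.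
Proof.
apply: (birth_chain_comparison R F) => //.
- exact: S_cdf_le1.
- exact: S_cdf_nd.
- exact: S_cdf0.
- exact: S_cdf_tail.
- exact: S_cdf_incr_le.
- exact: S_cdf_incr_ge.
- exact: depth_tail0.
- exact: depth_tail_start.
- exact: depth_tailS.
Qed.

(** Each of the [K] levels of the window costs two errors [level_error]; below the
    window only [Z n] has mass, namely [1 - H n 0 = h n 0 - H n 0], and above it the
    mass of [Z n] is at most [2 * n / 2 ^+ K]. *)
Lemma depth_approximation n K (A : set int) : (0 < n)%N ->
  n%:R ^+ 2 <= 2 ^+ K :> R ->
  `|fine (P [set w | A (X n w)]) - fine (P' [set w | A (Z n w)])| <=
  16 * (K%:R + 8) ^+ 2 / n%:R.
Proof.
move=> n0 nK; have nR : 0 < n%:R :> R by rewrite ltr0n.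
apply: le_trans (total_variation_window R _ _ _ _ P P' (X n) (Z n)
  (mX n) (mZ n) A K) _.
rewrite X_window Z_window// ler_pdivlMr// mulrC.
have K0 : 0 <= K%:R :> R by [].
have e_le k : (k <= K)%N -> n%:R * `|h n k - H n k| <= 8 * K%:R + 64.
  by move=> kK; apply: le_trans (level_error n k) _; rewrite lerD2r ler_pM2l// ler_nat.
have S_le : n%:R * \sum_(k < K)
    `|int_pmf R d Omega P (X n) k - int_pmf R d' Omega' P' (Z n) k| <=
    K%:R * (2 * (8 * K%:R + 64)).
  rewrite mulr_sumr -[K in K%:R * _]card_ord -sum1_card natr_sum mulr_suml.
  apply: ler_sum => k _; rewrite mul1r X_pmf Z_pmf//.
  have := e_le k (ltnW (ltn_ord k)); have := e_le k.+1 (ltn_ord k).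
  rewrite (_ : h n k - h n k.+1 - (H n k - H n k.+1) =
     (h n k - H n k) - (h n k.+1 - H n k.+1)); last by ring.
  have := ler_wpM2l (ltW nR) (ler_normB (h n k - H n k) (h n k.+1 - H n k.+1)).
  by lra.
have HK : n%:R * H n K <= 2.
  have nK0 : 0 <= n%:R / 2 ^+ K :> R by rewrite divr_ge0 ?exprn_ge0.
  have := S_cdf_incr_le R d' Omega' P' Y Y_indep Y_exp 0 (n%:R / 2 ^+ K)
            (lexx _) nK0.
  rewrite add0r S_cdf0// !subr0 -/F -/(H n K) => HKle.
  have F1 : F (2 * (n%:R / 2 ^+ K)) <= 1 by exact: S_cdf_le1.
  have : n%:R * (n%:R / 2 ^+ K) <= 1 :> R.
    by rewrite mulrA -expr2 ler_pdivrMr ?exprn_gt0// mul1r.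
  have := ler_wpM2l (mulr_ge0 (ler0n R 2) nK0) F1.
  by move: HKle; nra.
have e0 := e_le 0%N (leq0n _); have eK := e_le K (leqnn _).
have h0 : h n 0 = 1 by exact: depth_tail0.
have l0 := ler_wpM2l (ltW nR) (ler_norm (h n 0 - H n 0)).
have lK := ler_wpM2l (ltW nR) (ler_norm (h n K - H n K)).
rewrite h0 in l0 e0.
by lra.
Qed.

End two_chains.

Theorem theorem4 (R : realType)
    (d : measure_display) (Omega : measurableType d) (P : probability Omega R)
    (U : nat -> {RV P >-> R})
    (U_indep : mutually_independent U)
    (U_unif : forall n, has_law (U n) (uniform_prob (@ltr01 R)))
    (d' : measure_display) (Omega' : measurableType d')
    (P' : probability Omega' R)
    (Y : nat -> {RV P' >-> R})
    (Y_indep : mutually_independent Y)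
    (Y_exp : forall k, has_law (Y k) (exponential_prob 2))
    (theta : nat -> bool) (gamma : R) (gamma_lt1 : gamma < 1) :
  (fun n : nat => dTV (centered_depth_law U theta n)
                      (Q Y (frac_part (log2 (n%:R : R))))) =o_\oo
  (fun n : nat => (n%:R : R) `^ (- gamma)).
Proof.
have TV n K : (0 < n)%N -> n%:R ^+ 2 <= 2 ^+ K :> R ->
    `|dTV (centered_depth_law U theta n) (Q Y (frac_part (log2 (n%:R : R))))| <=
    16 * (K%:R + 8) ^+ 2 / n%:R.
  move=> n0 nK; set l := Num.floor (log2 (n%:R : R)).
  have ub B : measurable B ->
      `|fine (centered_depth_law U theta n B) -
        fine (Q Y (frac_part (log2 (n%:R : R))) B)| <= 16 * (K%:R + 8) ^+ 2 / n%:R.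
    move=> mB; pose A : set int := [set j | B (j - l)%:~R].
    have := depth_approximation R d Omega P U U_indep U_unif theta d' Omega' P'
      Y Y_indep Y_exp n K A n0 nK.
    congr (`|fine (P _) - fine (P' _)| <= _).
      apply/seteqP; split => w; rewrite /A /= rmorphB//=.
    (* [floor] commutes with the integer shift [l], which turns [frac_part] into
       the logarithm itself. *)
    have fl w : Num.floor (- log2 (S_infty Y w) + frac_part (log2 n%:R)) =
        Num.floor (log2 n%:R - log2 (S_infty Y w)) - l :> int.
      rewrite /frac_part -/l addrA [- log2 _ + _]addrC -rmorphN floorDrz ?intrKfloor//.
      exact: intr_int.
    by apply/seteqP; split => w; rewrite /A /= fl.
  rewrite /dTV; set f := fun B : set R => `|fine _ - fine _|.
  have f0 : [set f B | B in (measurable : set (set R))] (f set0).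
    by exists set0; first exact: measurable0.
  have fub : ubound [set f B | B in (measurable : set (set R))]
                    (16 * (K%:R + 8) ^+ 2 / n%:R).
    by move=> _ [B mB <-]; exact: ub.
  rewrite ger0_norm; first by apply: ge_sup fub; exists (f set0).
  apply: le_trans (ub_le_sup _ f0); first exact: normr_ge0.
  by exists (16 * (K%:R + 8) ^+ 2 / n%:R).
(* [(log n) ^ 2] costs [n ^ (2 * e)], and [2 * e - 1 = - gamma - e]. *)
pose e := (1 - gamma) / 3; have e0 : 0 < e by rewrite divr_gt0 ?subr_gt0.
pose C : R := 2 * (ln 2)^-1 * e^-1 + 9.
have ln2 : 0 < ln 2 :> R by rewrite ln_gt0// ltr1n.
have C0 : 0 < C by rewrite addr_gt0// !mulr_gt0 ?invr_gt0.
have bound n : (0 < n)%N ->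
    `|dTV (centered_depth_law U theta n) (Q Y (frac_part (log2 (n%:R : R))))| <=
    16 * C ^+ 2 * n%:R `^ (- e) * n%:R `^ (- gamma).
  move=> n0; have nR : 0 < n%:R :> R by rewrite ltr0n.
  have n1 : 1 <= n%:R :> R by rewrite ler1n.
  have l0 : 0 <= log2 (n%:R : R) by apply: divr_ge0; [exact: ln_ge0|exact: ltW].
  (* The least integer above [2 * log2 n], so that [n ^ 2 <= 2 ^ K]. *)
  pose K := (Num.truncn (2 * log2 (n%:R : R))).+1.
  have nK : n%:R ^+ 2 <= 2 ^+ K :> R.
    rewrite -ler_ln ?posrE ?exprn_gt0// !lnXn// -[leLHS]mulr_natl -[leRHS]mulr_natl.
    by rewrite -ler_pdivrMr// -mulrA; exact/ltW/truncnS_gt.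
  have Kle : K%:R + 8 <= C * n%:R `^ e.
    have : (Num.truncn (2 * log2 (n%:R : R)))%:R <= 2 * log2 (n%:R : R).
      by rewrite truncn_le mulr_ge0.
    have p1 : 1 <= n%:R `^ e by rewrite -[leLHS](powRr0 n%:R) ler_powR// ltW.
    have := ler_wpM2l (ltW (divr_gt0 (ltr0n R 2) ln2)) (ln_le_powR R n%:R e nR e0).
    rewrite /K /C -natr1 /log2; nra.
  apply: le_trans (TV n K n0 nK) _.
  have : (K%:R + 8) ^+ 2 <= (C * n%:R `^ e) ^+ 2.
    by rewrite lerXn2r// ?nnegrE ?addr_ge0// mulr_ge0 ?powR_ge0// ltW.
  have -> : 16 * C ^+ 2 * n%:R `^ (- e) * n%:R `^ (- gamma) =
      16 * (C * n%:R `^ e) ^+ 2 / n%:R.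
    have xV : n%:R^-1 = n%:R `^ (-1) :> R by rewrite powRN powRr1// ltW.
    have xD a b : n%:R `^ a * n%:R `^ b = n%:R `^ (a + b) :> R.
      by rewrite powRD// (gt_eqF nR) implybT.
    rewrite exprMn !expr2 xV -!mulrA !xD; congr (_ * (_ * (_ * _ `^ _))).
    by rewrite /e; field.
  by move=> le; rewrite ler_pM2r ?invr_gt0// ler_pM2l.
apply/eqoP => eps eps0.
near=> n.
have n0 : (0 < n)%N by near: n; exact: nbhs_infty_gt.
apply: le_trans (bound n n0) _.
rewrite (ger0_norm (powR_ge0 _ _)) ler_wpM2r ?powR_ge0//.
have nR : 0 < n%:R :> R by rewrite ltr0n.
pose M := 16 * C ^+ 2 / eps.
have M0 : 0 < M by rewrite divr_gt0// mulr_gt0// exprn_gt0.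
have Mn : M `^ e^-1 <= n%:R by near: n; exact: nbhs_infty_ger.
have : M <= n%:R `^ e.
  have := ge0_ler_powR (ltW e0) (powR_ge0 _ _) (ltW nR) Mn.
  by rewrite -powRrM mulVf ?gt_eqF// (powRr1 (ltW M0)).
rewrite powRN /M ler_pdivrMr// => h.
by rewrite ler_pdivrMr ?powR_gt0// [leRHS]mulrC.
Unshelve. all: by end_near. Qed.
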